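(* Let $n=2$ and let $\mathbb{F}$ be a field with $\mathrm{char}(\mathbb{F})=2$. Let $\Delta_2$ be the dual polar space associated to a non-singular quadratic form of Witt index $2$ on $V(5,\mathbb{F})$. Then the veronesean Weyl embedding $\tilde{\varepsilon}_2$ of $\Delta_2$ is not relatively universal.
   Context: $V(m,\mathbb{F})$ is an $m$-dimensional vector space over $\mathbb{F}$. A veronesean embedding of a point-line geometry $\Gamma=(\mathcal{P},\mathcal{L})$ in a vector space $W$ is an injective map $\varepsilon$ from $\mathcal{P}$ to the set of points (1-dimensional subspaces) of $\mathrm{PG}(W)$ mapping every line of $\Gamma$ onto a non-singular conic of $\mathrm{PG}(W)$, with $\varepsilon(p)\cap\langle\varepsilon(l)\rangle=0$ for every non-incident point-line pair $(p,l)$ and with $\varepsilon(\mathcal{P})$ spanning $W$. A morphism from $\varepsilon_1:\Gamma\to W_1$ to $\varepsilon_2:\Gamma\to W_2$ is a semilinear map $f:W_1\to W_2$ with $\varepsilon_2=f\circ\varepsilon_1$ (it is then surjective); if it exists, $\varepsilon_2$ is called a quotient of $\varepsilon_1$, a proper quotient if $f$ is not bijective. A veronesean embedding of $\Gamma$ is relatively universal if it is not a proper quotient of any other veronesean embedding of $\Gamma$. The quadratic form $q$ is non-singular of Witt index 2: $V(5,\mathbb{F})$ is the orthogonal sum of two hyperbolic planes and a 1-space on which $q$ does not vanish. $\Delta_2$ is the point-line geometry whose points are the 2-dimensional totally singular subspaces of $V(5,\mathbb{F})$ and whose lines are the sets $l_X$ of all 2-dimensional totally singular subspaces containing a given 1-dimensional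 totally singular subspace $X$. $G=\mathrm{Spin}(5,\mathbb{F})$ is the universal Chevalley group of type $B_2$, $\lambda_2$ the fundamental dominant weight of the short simple root, and $V(2\lambda_2)$ the Weyl $G$-module of highest weight $2\lambda_2$ (of dimension 10), i.e. $\mathbb{F}\otimes_{\mathbb{Z}}L$ with $L$ the minimal admissible lattice of the irreducible complex module of highest weight $2\lambda_2$. The veronesean Weyl embedding $\tilde{\varepsilon}_2:\Delta_2\to V(2\lambda_2)$ maps $g(X_0)$ to $g(\langle v_0\rangle)$ for $g\in G$, where $v_0$ is a highest weight vector of $V(2\lambda_2)$ and $X_0$ is the point of $\Delta_2$ stabilized by the stabilizer of $\langle v_0\rangle$ in $G$. *)

(* Defs.v *)
From HB Require Import structures.
From mathcomp Require Import all_boot all_order all_algebra.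
From mathcomp Require Import boolp classical_sets.
From mathcomp Require Import complex.
From mathcomp Require Import Rstruct.
From mathcomp Require Import ring.

Set Implicit Arguments.
Unset Strict Implicit.
Unset Printing Implicit Defensive.

Import GRing.Theory.
Local Open Scope ring_scope.
Local Open Scope classical_set_scope.

(** * Quadratic forms *)

Section QuadraticForms.
Variables (F : fieldType) (V : lmodType F).
Implicit Types (q : V -> F) (x y z : V).

Definition polar q x y : F := q (x + y) - q x - q y.

Definition quadratic_form q : Prop :=
  (forall (a : F) x, q (a *: x) = a ^+ 2 * q x) /\
  (forall (a : F) x y z, polar q (a *: x + y) z = a * polar q x z + polar q y z).

(* The radical of the polar form may be nonzero (it always is when dim V is
   odd and char F = 2), but [q] must not vanish on a nonzero vector of it. *)
Definition nonsingular_form q : Prop :=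
  quadratic_form q /\
  forall x, q x = 0 -> (forall y, polar q x y = 0) -> x = 0.

Definition hyperbolic_pair q x y : Prop :=
  [/\ q x = 0, q y = 0 & polar q x y = 1].

End QuadraticForms.

(* V is the orthogonal sum of the hyperbolic planes <e1, f1> and <e2, f2> and
   of a 1-space <d> on which q does not vanish. *)
Definition nonsingular_witt2 (F : fieldType) (q : 'cV[F]_5 -> F) : Prop :=
  quadratic_form q /\
  exists e1 e2 d f2 f1 : 'cV[F]_5,
    [/\ basis_of fullv [:: e1; e2; d; f2; f1],
        hyperbolic_pair q e1 f1 /\ hyperbolic_pair q e2 f2,
        [/\ polar q e1 e2 = 0, polar q e1 f2 = 0,
            polar q f1 e2 = 0 & polar q f1 f2 = 0],
        [/\ polar q e1 d = 0, polar q f1 d = 0,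
            polar q e2 d = 0 & polar q f2 d = 0]
      & q d != 0].

(** * Point-line geometries and veronesean embeddings *)

Record geometry := Geometry { point : Type; line : set (set point) }.

Section Projective.
Variables (K : fieldType) (W : lmodType K).

(* A point of PG(W) is a 1-dimensional subspace of W, as a set of vectors. *)
Definition span1 (w : W) : set W := [set a *: w | a in [set: K]].

Definition proj_point (A : set W) : Prop := exists2 w : W, w != 0 & A = span1 w.

Definition subspace (U : set W) : Prop :=
  U 0 /\ forall (a : K) (u v : W), U u -> U v -> U (a *: u + v).

Definition lspan (A : set W) : set W := smallest subspace A.

(* The plane of PG(W) carrying the conic is given by an injective linear map
   u : K^3 -> W. *)
Definition nonsingular_conic (C : set (set W)) : Prop :=
  exists (u : {linear 'cV[K]_3 -> W}) (Q : 'cV[K]_3 -> K),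
    [/\ injective u, nonsingular_form Q &
        C = [set span1 (u x) | x in [set x : 'cV[K]_3 | x != 0 /\ Q x = 0]]].

Definition veronesean_embedding (G : geometry) (eps : point G -> set W) : Prop :=
  [/\ forall p, proj_point (eps p),
      injective eps,
      forall l, line l -> nonsingular_conic (eps @` l),
      forall p l, line l -> ~ l p ->
        eps p `&` lspan (\bigcup_(r in l) eps r) = [set 0]
    & lspan (\bigcup_(p in [set: point G]) eps p) = [set: W]].

End Projective.

(* Semilinear maps are relative to an isomorphism of the ground fields. *)
Definition semilinear (K1 K2 : fieldType) (W1 : lmodType K1) (W2 : lmodType K2)
    (f : W1 -> W2) : Prop :=
  exists sigma : {rmorphism K1 -> K2}, bijective sigma /\
    forall (a : K1) (u v : W1), f (a *: u + v) = sigma a *: f u + f v.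

Definition veronesean_morphism (G : geometry) (K1 K2 : fieldType)
    (W1 : lmodType K1) (W2 : lmodType K2)
    (eps1 : point G -> set W1) (eps2 : point G -> set W2) (f : W1 -> W2) : Prop :=
  [/\ veronesean_embedding eps1, veronesean_embedding eps2,
      semilinear f & forall p, eps2 p = f @` eps1 p].

(* eps2 is a proper quotient of eps1. *)
Definition proper_quotient (G : geometry) (K1 K2 : fieldType)
    (W1 : lmodType K1) (W2 : lmodType K2)
    (eps1 : point G -> set W1) (eps2 : point G -> set W2) : Prop :=
  exists2 f : W1 -> W2, veronesean_morphism eps1 eps2 f & ~ bijective f.

(* By the definition of morphisms, the negation of this entails that eps is a
   veronesean embedding. *)
Definition relatively_universal (G : geometry) (K : fieldType) (W : lmodType K)
    (eps : point G -> set W) : Prop :=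
  forall (K1 : fieldType) (W1 : lmodType K1) (eps1 : point G -> set W1),
    ~ proper_quotient eps1 eps.

(** * The dual polar space of a quadratic form on V(5, F) *)

Section DualPolarSpace.
Variables (F : fieldType) (q : 'cV[F]_5 -> F).

Definition totally_singular (X : {vspace 'cV[F]_5}) : Prop :=
  forall x, x \in X -> q x = 0.

Definition dps_point : Type :=
  {X : {vspace 'cV[F]_5} | \dim X = 2%N /\ totally_singular X}.

Definition dps_line : set (set dps_point) :=
  [set l | exists X : {vspace 'cV[F]_5},
     [/\ \dim X = 1%N, totally_singular X &
         l = [set p | (X <= sval p)%VS]]].

Definition dual_polar_space : geometry := Geometry dps_line.

End DualPolarSpace.

(** * Admissible lattices of type B_2 *)

(* Positive roots of B_2; the simple roots are alpha_1 (long) and alpha_2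
   (short). *)
Variant posroot :=
  | A1   (* alpha_1 *)
  | A2   (* alpha_2 *)
  | A12  (* alpha_1 + alpha_2 *)
  | A122 (* alpha_1 + 2 alpha_2 *).

Variant B2_root := Pos of posroot | Neg of posroot.

Definition bracket (d : nat) (A B : 'M[int]_d) : 'M[int]_d := A *m B - B *m A.

(* Serre presentation, with Cartan integers alpha_2(h_1) = -1 and
   alpha_1(h_2) = -2; [B2_roots] expresses the root vectors of the Chevalley basis
   for the non-simple roots through those for the simple ones. *)
Record B2_chevalley_basis (d : nat) (e f : posroot -> 'M[int]_d)
    (h1 h2 : 'M[int]_d) : Prop := {
  B2_coroots : h1 = bracket (e A1) (f A1) /\ h2 = bracket (e A2) (f A2);
  B2_cartan : bracket h1 h2 = 0;
  B2_ef : bracket (e A1) (f A2) = 0 /\ bracket (e A2) (f A1) = 0;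
  B2_he : [/\ bracket h1 (e A1) = e A1 *+ 2, bracket h1 (e A2) = - e A2,
              bracket h2 (e A1) = - (e A1 *+ 2) & bracket h2 (e A2) = e A2 *+ 2];
  B2_hf : [/\ bracket h1 (f A1) = - (f A1 *+ 2), bracket h1 (f A2) = f A2,
              bracket h2 (f A1) = f A1 *+ 2 & bracket h2 (f A2) = - (f A2 *+ 2)];
  B2_serre_e : bracket (e A1) (bracket (e A1) (e A2)) = 0 /\
    bracket (e A2) (bracket (e A2) (bracket (e A2) (e A1))) = 0;
  B2_serre_f : bracket (f A1) (bracket (f A1) (f A2)) = 0 /\
    bracket (f A2) (bracket (f A2) (bracket (f A2) (f A1))) = 0;
  B2_roots : [/\ e A12 = bracket (e A1) (e A2),
                 e A122 *+ 2 = bracket (e A12) (e A2),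
                 f A12 = bracket (f A2) (f A1) &
                 f A122 *+ 2 = bracket (f A2) (f A12)]
}.

(* A lattice Z^d in a complex representation of the simple Lie algebra of type
   B_2, stable under the Kostant Z-form of the enveloping algebra: [dp r k] is
   the matrix of the divided power e_r^k / k! of the root vector e_r. *)
Record B2_lattice (d : nat) := B2Lattice {
  dp : B2_root -> nat -> 'M[int]_d;
  coroot1 : 'M[int]_d;
  coroot2 : 'M[int]_d;
  dpE : forall r k, dp r 1%N ^+ k = dp r k *+ k`!;
  dp_basis : B2_chevalley_basis (fun r => dp (Pos r) 1%N) (fun r => dp (Neg r) 1%N)
               coroot1 coroot2
}.

Definition red (R : pzRingType) (m n : nat) (A : 'M[int]_(m, n)) : 'M[R]_(m, n) :=
  map_mx intr A.

Local Notation C := (complex Rdefinitions.R).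

Definition complex_irreducible (d : nat) (L : B2_lattice d) : Prop :=
  (0 < d)%N /\
  forall U : {vspace 'cV[C]_d},
    (forall (r : B2_root) (u : 'cV[C]_d), u \in U -> red C (dp L r 1) *m u \in U) ->
    U = 0%VS \/ U = fullv.

Definition highest_weight_vector (d : nat) (L : B2_lattice d) (m1 m2 : int)
    (v0 : 'cV[int]_d) : Prop :=
  [/\ v0 != 0, forall r, dp L (Pos r) 1 *m v0 = 0,
      coroot1 L *m v0 = m1 *: v0 & coroot2 L *m v0 = m2 *: v0].

(* L = U_Z v0, with U_Z the Kostant Z-form. *)
Definition minimal_lattice (d : nat) (L : B2_lattice d) (v0 : 'cV[int]_d) : Prop :=
  forall P : set 'cV[int]_d,
    P v0 -> (forall u v, P u -> P v -> P (u - v)) ->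
    (forall r k v, P v -> P (dp L r k *m v)) ->
    P = [set: 'cV[int]_d].

(* L is the minimal admissible lattice, generated by the highest weight vector
   v0, of the irreducible complex module of highest weight
   m1 lambda_1 + m2 lambda_2, in coordinates with respect to a Z-basis of L.
   The Weyl module over F is then F \otimes L = 'cV[F]_d. *)
Definition weyl_lattice (d : nat) (L : B2_lattice d) (m1 m2 : int)
    (v0 : 'cV[int]_d) : Prop :=
  [/\ complex_irreducible L, highest_weight_vector L m1 m2 v0
    & minimal_lattice L v0].

(** * The universal Chevalley group of type B_2 *)

(* x_r(t) = \sum_k t^k e_r^k / k! on F \otimes L; as e_r is nilpotent, the
   terms with k >= d vanish. *)
Definition root_elt (F : fieldType) (r : B2_root) (t : F) (d : nat)
    (L : B2_lattice d) : 'M[F]_d :=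
  \sum_(k < d) t ^+ k *: red F (dp L r k).

(* Spin(5, F), as the group generated by the root elements x_r(t) acting
   simultaneously on all the modules F \otimes L.  Since the spin module is
   among them and its weights span the weight lattice, this is the universal
   Chevalley group.  Inverses need not be included: x_r(t)^-1 = x_r(-t). *)
Definition spin5 (F : fieldType) : set (forall d, B2_lattice d -> 'M[F]_d) :=
  [set g | exists w : seq (B2_root * F),
     g = fun d L => \prod_(x <- w) root_elt x.1 x.2 L].

(** * The natural 5-dimensional module *)

Definition dmx (i j : nat) : 'M[int]_5 := delta_mx (inord i) (inord j).

(* The Lie algebra of the form x_0 x_4 + x_1 x_3 + x_2^2, on the weight basis
   of weights eps_1, eps_2, 0, - eps_2, - eps_1, where alpha_1 = eps_1 - eps_2
   and alpha_2 = eps_2. *)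
Definition nat5_rootvec (r : B2_root) : 'M[int]_5 :=
  match r with
  | Pos A1 => dmx 0 1 - dmx 3 4
  | Pos A2 => dmx 2 3 - dmx 1 2 *+ 2
  | Pos A12 => dmx 2 4 - dmx 0 2 *+ 2
  | Pos A122 => dmx 1 4 - dmx 0 3
  | Neg A1 => dmx 1 0 - dmx 4 3
  | Neg A2 => dmx 3 2 *+ 2 - dmx 2 1
  | Neg A12 => dmx 4 2 *+ 2 - dmx 2 0
  | Neg A122 => dmx 4 1 - dmx 3 0
  end.

Definition nat5_halfsquare (r : B2_root) : 'M[int]_5 :=
  match r with
  | Pos A2 => - dmx 1 3
  | Pos A12 => - dmx 0 4
  | Neg A2 => - dmx 3 1
  | Neg A12 => - dmx 4 0
  | _ => 0
  end.

Definition nat5_dp (r : B2_root) (k : nat) : 'M[int]_5 :=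
  match k with
  | 0 => 1%:M
  | 1 => nat5_rootvec r
  | 2 => nat5_halfsquare r
  | _ => 0
  end.

Lemma dmxM i j k l : (j < 5)%N -> (k < 5)%N ->
  dmx i j * dmx k l = if j == k then dmx i l else 0.
Proof.
move=> j5 k5; rewrite -mulmxE /dmx mul_delta_mx_cond -val_eqE /= !inordK //.
by case: eqP.
Qed.

Local Ltac nat5_tac :=
  rewrite /bracket /nat5_dp /nat5_rootvec /nat5_halfsquare ?mulmxE;
  rewrite ?(mulrBl, mulrBr, mulrDl, mulrDr, mulNr, mulrN, mulrnAl, mulrnAr,
      dmxM, mulr0, mul0r, opprK, oppr0) //=;
  apply/matrixP => i j; rewrite !mxE; ring.

Lemma nat5_dpE r k : nat5_dp r 1 ^+ k = nat5_dp r k *+ k`!.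
Proof.
have sq : nat5_dp r 1 * nat5_dp r 1 = nat5_dp r 2 *+ 2.
  by case: r => -[]; nat5_tac.
have cube : nat5_dp r 2 * nat5_dp r 1 = 0.
  by case: r {sq} => -[]; nat5_tac.
case: k => [|[|[|k]]].
- by rewrite expr0.
- by rewrite expr1.
- by rewrite expr2 sq.
- by rewrite !exprS mulrA sq mulrnAl mulrA cube mul0r !mul0rn.
Qed.

Definition nat5_coroot1 : 'M[int]_5 := dmx 0 0 - dmx 1 1 + dmx 3 3 - dmx 4 4.
Definition nat5_coroot2 : 'M[int]_5 := (dmx 1 1 - dmx 3 3) *+ 2.

Lemma nat5_basis :
  B2_chevalley_basis (fun r => nat5_dp (Pos r) 1) (fun r => nat5_dp (Neg r) 1)
    nat5_coroot1 nat5_coroot2.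
Proof.
have bC d (A B : 'M[int]_d) : bracket A B = - bracket B A by rewrite /bracket opprB.
have bN d (A B : 'M[int]_d) : bracket A (- B) = - bracket A B.
  by rewrite /bracket mulmxN mulNmx opprD.
have bn d (A B : 'M[int]_d) n : bracket A (B *+ n) = bracket A B *+ n.
  by rewrite /bracket !mulmxE mulrnAr mulrnAl mulrnBl.
have e12 : nat5_dp (Pos A12) 1 = bracket (nat5_dp (Pos A1) 1) (nat5_dp (Pos A2) 1).
  by nat5_tac.
have e122 : nat5_dp (Pos A122) 1 *+ 2
    = bracket (nat5_dp (Pos A12) 1) (nat5_dp (Pos A2) 1).
  by nat5_tac.
have f12 : nat5_dp (Neg A12) 1 = bracket (nat5_dp (Neg A2) 1) (nat5_dp (Neg A1) 1).
  by nat5_tac.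
have f122 : nat5_dp (Neg A122) 1 *+ 2
    = bracket (nat5_dp (Neg A2) 1) (nat5_dp (Neg A12) 1).
  by nat5_tac.
split; rewrite /nat5_coroot1 /nat5_coroot2.
- split; nat5_tac.
- nat5_tac.
- split; nat5_tac.
- split; nat5_tac.
- split; nat5_tac.
- split; first by rewrite -e12; nat5_tac.
  rewrite [X in bracket _ (bracket _ X)]bC -e12 bN (bC _ _ (nat5_dp (Pos A12) 1)).
  by rewrite -e122 opprK bn; nat5_tac.
- split; last by rewrite -f12 -f122 bn; nat5_tac.
  by rewrite [X in bracket _ X]bC -f12 bN; nat5_tac.
- by split; [exact: e12 | exact: e122 | exact: f12 | exact: f122].
Qed.

Definition nat5 : B2_lattice 5 := B2Lattice nat5_dpE nat5_basis.

Definition nat5_form (F : fieldType) (x : 'cV[F]_5) : F :=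
  x (inord 0) 0 * x (inord 4) 0 + x (inord 1) 0 * x (inord 3) 0
    + x (inord 2) 0 ^+ 2.

(** * The veronesean Weyl embedding *)

Section WeylEmbedding.
Variables (F : fieldType) (q : 'cV[F]_5 -> F).

(* P identifies F \otimes Z^5 with V(5, F), carrying [nat5_form] to q up to a
   scalar; this is how Spin(5, F) acts on V(5, F) as a group of isometries of q.
   Every non-singular form of Witt index 2 admits such a P: multiply e1 and e2
   by q(d) in the decomposition of [nonsingular_witt2]. *)
Definition natural_identification (P : 'M[F]_5) : Prop :=
  P \in unitmx /\ exists2 c : F, c != 0 & forall x, q (P *m x) = c * nat5_form x.

Variable (P : 'M[F]_5).

Definition act5 (g : forall d, B2_lattice d -> 'M[F]_d)
    (X : {vspace 'cV[F]_5}) : {vspace 'cV[F]_5} :=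
  (linfun (mulmx (P *m g 5%N nat5 *m invmx P)) @: X)%VS.

Variables (d : nat) (L : B2_lattice d) (v0 : 'cV[int]_d).

(* g<v0>, with v0 standing for 1 \otimes v0 in F \otimes L. *)
Definition act_v0 (g : forall d, B2_lattice d -> 'M[F]_d) : set 'cV[F]_d :=
  span1 (g d L *m red F v0).

Definition stabilized_point (X0 : dps_point q) : Prop :=
  forall g, spin5 g -> act_v0 g = span1 (red F v0) -> act5 g (sval X0) = sval X0.

(* g(X0) |-> g<v0>, as the union of the g<v0> over all g with g(X0) = X. *)
Definition weyl_embedding (X0 : dps_point q) : dps_point q -> set 'cV[F]_d :=
  fun X => \bigcup_(g in [set g | spin5 g /\ act5 g (sval X0) = sval X]) act_v0 g.

End WeylEmbedding.

(* Main.v *)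
Require Import Defs.
From HB Require Import structures.
From mathcomp Require Import all_boot all_order all_algebra.
From mathcomp Require Import boolp classical_sets.
From mathcomp Require Import complex Rstruct.
From mathcomp Require Import ring.

(** The points of the dual polar space are the points <x> of PG(3, F): with
    [clifford v] the 4 x 4 matrix of Clifford multiplication, whose square is
    the value of the quadratic form at v, every totally singular plane is the
    annihilator {v | clifford v *m x = 0} of a spinor x, unique up to scalars
    ([totally_singular_star], [star_inj]), and a totally singular vector v
    gives the line of all spinors in the 2-dimensional space ker (clifford v).
    In characteristic 2 these kernels are isotropic for the symplectic form
    [sympl] ([clifford_kernel]).

    In these coordinates the veronesean Weyl embedding is the quadric Veronese
    map x |-> x x^T into the symmetric 4 x 4 matrices ([weyl_embeddingE]).  To
    see this, compare the given lattice L with the lattice of symmetric integer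
    matrices, on which the algebra acts through the spin lattice.  The
    submodule of Sym x L generated by the pair of highest weight vectors is the
    graph of a map Sym -> L: the vectors w with (0, w) in it form a submodule
    of L, which does not contain the highest weight vector and hence vanishes
    by irreducibility ([cyclic_functional]).  Minimality of L makes this map
    onto; both lattices have rank 10, so it is unimodular and stays bijective
    over F ([square_iso]).

    An embedding of the geometry only has to look like a Veronese map on
    isotropic lines, and this leaves room for one more coordinate.  The
    quadratic form Q(x) = x_0 x_3 + x_1 x_2 polarizes to [sympl], so on an
    isotropic plane Q(s u + t v) = s^2 Q(u) + t^2 Q(v): it is a linear function
    with values in F twisted by the Frobenius map (a acts on F as a^2).  Hence
    x_0^2 Q(x), with values in the twisted F, is a quadratic function on every
    isotropic plane, but not a linear function of x x^T.  Appending it to the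
    Weyl embedding gives a veronesean embedding
    ([veronesean_of_quadratic]) which spans Sym x F ([cover_vector_span]), and
    the projection that forgets the new coordinate is a morphism onto the Weyl
    embedding with nonzero kernel. *)

Set Implicit Arguments.
Unset Strict Implicit.
Unset Printing Implicit Defensive.

Import GRing.Theory.
Local Open Scope ring_scope.

(** * Coordinates and subspaces *)

Lemma ord4P (i : 'I_4) : [\/ i = inord 0, i = inord 1, i = inord 2 | i = inord 3].
Proof.
case: i => [[|[|[|[|//]]]] p];
  [apply: Or41 | apply: Or42 | apply: Or43 | apply: Or44];
  by apply: val_inj; rewrite /= inordK.
Qed.

Lemma big_ord4 (R : pzRingType) (f : 'I_4 -> R) :
  \sum_i f i = f (inord 0) + f (inord 1) + f (inord 2) + f (inord 3).
Proof.
rewrite !big_ord_recr big_ord0 /= add0r.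
by congr (f _ + f _ + f _ + f _); apply: val_inj; rewrite /= inordK.
Qed.

Lemma inord_eq n i j : (i < n.+1)%N -> (j < n.+1)%N ->
  ((inord i : 'I_n.+1) == inord j) = (i == j).
Proof. by move=> *; rewrite -val_eqE /= !inordK. Qed.

Lemma ord5P (P : 'I_5 -> Prop) : P (inord 0) -> P (inord 1) -> P (inord 2) ->
  P (inord 3) -> P (inord 4) -> forall i, P i.
Proof.
move=> P0 P1 P2 P3 P4 i.
case: i => [[|[|[|[|[|//]]]]] p]; [move: P0 | move: P1 | move: P2 | move: P3 | move: P4];
by congr P; apply: val_inj; rewrite /= inordK.
Qed.

Lemma col4P (F : fieldType) (x y : 'cV[F]_4) : x (inord 0) 0 = y (inord 0) 0 ->
  x (inord 1) 0 = y (inord 1) 0 -> x (inord 2) 0 = y (inord 2) 0 -> x (inord 3) 0 = y (inord 3) 0 -> x = y.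
Proof. by move=> *; apply/colP => i; case: (ord4P i) => ->. Qed.

Lemma col3P (F : fieldType) (x y : 'cV[F]_3) : x (inord 0) 0 = y (inord 0) 0 ->
  x (inord 1) 0 = y (inord 1) 0 -> x (inord 2) 0 = y (inord 2) 0 -> x = y.
Proof.
move=> h0 h1 h2; apply/colP=> -[[|[|[|//]]] p]; [move: h0 | move: h1 | move: h2];
by congr (_ = _); congr (_ _ 0); apply: val_inj; rewrite /= inordK.
Qed.

Lemma red_scale (R : comPzRingType) m n (a : int) (A : 'M[int]_(m, n)) :
  red R (a *: A) = a%:~R *: red R A.
Proof. by apply/matrixP=> i j; rewrite !mxE intrM. Qed.

Lemma red_Mn (R : comPzRingType) m n (A : 'M[int]_(m, n)) k :
  red R (A *+ k) = red R A *+ k.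
Proof.
elim: k => [|k IH]; first by rewrite !mulr0n /red map_mx0.
by rewrite !mulrS -IH /red map_mxD.
Qed.

Lemma red_delta (R : comPzRingType) m n i j :
  red R (delta_mx i j : 'M[int]_(m, n)) = delta_mx i j.
Proof. by apply/matrixP=> k l; rewrite !mxE; case: (_ && _). Qed.

Lemma int_col_ind n (P : 'cV[int]_n.+1 -> Prop) :
  (forall u v, P u -> P v -> P (u - v)) -> (forall k, P (delta_mx k 0)) ->
  forall c, P c.
Proof.
move=> PB Pd c.
have P0 : P 0 by rewrite -(subrr (delta_mx ord0 0)); apply: PB.
have PN u : P u -> P (- u) by rewrite -sub0r; apply: PB.
have PD u v : P u -> P v -> P (u + v) by move=> Pu Pv; rewrite -[v]opprK; apply/PB/PN.
have Pn u n' : P u -> P (u *+ n').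
  by move=> Pu; elim: n' => // m IH; rewrite mulrS; apply: PD.
rewrite [c]matrix_sum_delta; apply: big_ind => // i _; rewrite big_ord1.
case: (c i 0) => m; first by rewrite -natz scaler_nat; apply: Pn.
by rewrite NegzE scaleNr -natz scaler_nat; apply/PN/Pn.
Qed.

Lemma linear_col_ext (R : pzRingType) (n : nat) (V : lmodType R) (f g : 'cV[R]_n -> V) :
  linear f -> linear g -> (forall k, f (delta_mx k 0) = g (delta_mx k 0)) -> f =1 g.
Proof.
move=> lf lg fg c.
have f0 : f 0 = 0 by have := lf (-1) 0 0; rewrite scaler0 addr0 scaleN1r addNr.
have g0 : g 0 = 0 by have := lg (-1) 0 0; rewrite scaler0 addr0 scaleN1r addNr.
rewrite [c]matrix_sum_delta.
have : forall P : seq 'I_n, f (\sum_(i <- P) \sum_(j < 1) c i j *: delta_mx i j)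
    = g (\sum_(i <- P) \sum_(j < 1) c i j *: delta_mx i j).
  elim=> [|i P IH]; first by rewrite !big_nil f0 g0.
  by rewrite !big_cons big_ord1 lf lg IH ord1 fg.
exact.
Qed.

(** Subspaces defined by a condition on vectors become bundled subspaces; the
    bundled one is of maximal dimension among those satisfying the condition. *)
Lemma vspace_of_pred (K : fieldType) (vT : vectType K) (P : vT -> Prop) :
  P 0 -> (forall a u v, P u -> P v -> P (a *: u + v)) ->
  exists U : {vspace vT}, forall u, u \in U <-> P u.
Proof.
move=> P0 Plin.
pose good k := `[< exists U : {vspace vT}, \dim U = k /\ forall u, u \in U -> P u >].
have ex_good : exists k, good k.
  by exists 0%N; apply/asboolP; exists 0%VS; split=> [|u]; rewrite ?dimv0 // memv0 => /eqP->.
have good_le k : good k -> (k <= \dim {:vT})%N.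
  by move=> /asboolP[U [<- _]]; rewrite dimvS ?subvf.
case: (ex_maxnP ex_good good_le) => k /asboolP[U [dimU UP]] kmax.
exists U => u; split=> [/UP //|Pu].
have UuP w : w \in (<[u]> + U)%VS -> P w.
  by move=> /memv_addP[_ /vlineP[a ->] [z /UP Pz ->]]; exact: Plin.
have le : (\dim (<[u]> + U)%VS <= \dim U)%N.
  by rewrite dimU; apply: kmax; apply/asboolP; exists (<[u]> + U)%VS.
have /eqP UE : U == (<[u]> + U)%VS by rewrite eqEdim addvSr.
by rewrite UE memvE addvSl.
Qed.

Lemma vspace_dim2 (F : fieldType) (vT : vectType F) (U : {vspace vT}) : \dim U = 2 ->
  exists u1 u2, (forall x : vT, x \in U <-> exists s t, x = s *: u1 + t *: u2) /\
    (forall s t, s *: u1 + t *: u2 = 0 -> s = 0 /\ t = 0).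
Proof.
move=> dU.
have [u1 [u2 bE]] : exists u1 u2, vbasis U = [:: u1; u2] :> seq _.
  have : size (vbasis U) = 2 by rewrite size_tuple.
  by case: (tval (vbasis U)) => [|u1 [|u2 []]] // _; exists u1, u2.
have := vbasisP U; rewrite bE => /andP[/eqP spanU freeU].
exists u1, u2; split=> [x|s t].
  rewrite -spanU span_cons span_seq1; split.
    by case/memv_addP=> _ /vlineP[s ->] [_ /vlineP[t ->] ->]; exists s, t.
  by case=> s [t ->]; apply: memv_add; apply: memvZ; apply: memv_line.
move: freeU => /(@freeP _ _ 2 [tuple u1; u2])/(_ (fun i => [:: s; t]`_i)).
rewrite !big_ord_recl big_ord0 /= addr0 => h /h k.
by split; [exact: (k ord0) | exact: (k (lift ord0 ord0))].
Qed.

(** * The spin lattice *)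

Definition smx (i j : nat) : 'M[int]_4 := delta_mx (inord i) (inord j).

Lemma smxM i j k l : (j < 4)%N -> (k < 4)%N ->
  smx i j * smx k l = if j == k then smx i l else 0.
Proof.
move=> j4 k4; rewrite -mulmxE /smx mul_delta_mx_cond -val_eqE /= !inordK //.
by case: eqP.
Qed.

Lemma smx_tr i j : (smx i j)^T = smx j i.
Proof. exact: trmx_delta. Qed.

(** The spin module has weights (1/2, 1/2), (1/2, -1/2), (-1/2, 1/2) and
    (-1/2, -1/2), in this order, so it is minuscule and all root vectors have
    square zero.  The signs agree with those of [nat5] in the sense of
    [clifford_root_elt]. *)
Definition spin_rootvec (r : B2_root) : 'M[int]_4 :=
  match r with
  | Pos A1 => smx 1 2
  | Pos A2 => smx 0 1 + smx 2 3
  | Pos A12 => smx 1 3 - smx 0 2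
  | Pos A122 => - smx 0 3
  | Neg A1 => smx 2 1
  | Neg A2 => smx 1 0 + smx 3 2
  | Neg A12 => smx 3 1 - smx 2 0
  | Neg A122 => - smx 3 0
  end.

Definition spin_dp (r : B2_root) (k : nat) : 'M[int]_4 :=
  match k with 0 => 1%:M | 1 => spin_rootvec r | _ => 0 end.

Local Ltac spin_tac :=
  rewrite /bracket /spin_dp /spin_rootvec ?mulmxE;
  rewrite ?(mulrBl, mulrBr, mulrDl, mulrDr, mulNr, mulrN, mulrnAl, mulrnAr,
      smxM, mulr0, mul0r, opprK, oppr0) //=;
  apply/matrixP => i j; rewrite !mxE; ring.

Lemma spin_rootvec_sqr r : spin_rootvec r * spin_rootvec r = 0.
Proof. by case: r => -[]; spin_tac. Qed.

Lemma spin_dpE r k : spin_dp r 1 ^+ k = spin_dp r k *+ k`!.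
Proof.
case: k => [|[|k]]; rewrite ?expr0 ?expr1 //.
by rewrite !exprS mulrA spin_rootvec_sqr mul0r mul0rn.
Qed.

Definition spin_coroot1 : 'M[int]_4 := smx 1 1 - smx 2 2.
Definition spin_coroot2 : 'M[int]_4 := smx 0 0 - smx 1 1 + smx 2 2 - smx 3 3.

Lemma spin_basis :
  B2_chevalley_basis (fun r => spin_dp (Pos r) 1) (fun r => spin_dp (Neg r) 1)
    spin_coroot1 spin_coroot2.
Proof.
split; rewrite /spin_coroot1 /spin_coroot2.
- split; spin_tac.
- spin_tac.
- split; spin_tac.
- split; spin_tac.
- split; spin_tac.
- split; spin_tac.
- split; spin_tac.
- split; spin_tac.
Qed.

Definition spin : B2_lattice 4 := B2Lattice spin_dpE spin_basis.

(** * The submodule generated by the two highest weight vectors *)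

(** The action of a Lie algebra element A on x x^T, extended to matrices; it is
    the symmetric square of the spin module. *)
Definition sq_act (R : pzRingType) (A m : 'M[R]_4) : 'M[R]_4 := A *m m + m *m A^T.

Section Pairs.
Variables (R : comPzRingType) (d : nat).
Implicit Types (X : 'M[int]_4) (Y : 'M[int]_d) (p : 'M[R]_4 * 'cV[R]_d).

Definition pair_act X Y p : 'M[R]_4 * 'cV[R]_d :=
  (sq_act (red R X) p.1, red R Y *m p.2).

Lemma pair_act_linear X Y : linear (pair_act X Y).
Proof.
move=> a p p'; rewrite /pair_act /sq_act /=; congr pair.
  by rewrite mulmxDr mulmxDl -scalemxAr -scalemxAl addrACA -scalerDr.
by rewrite mulmxDr -scalemxAr.
Qed.

Lemma pair_act0 p : pair_act 0 0 p = 0.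
Proof. by rewrite /pair_act /sq_act /red !map_mx0 trmx0 !mul0mx mulmx0 addr0. Qed.

Lemma pair_actN X Y p : pair_act (- X) (- Y) p = - pair_act X Y p.
Proof.
rewrite /pair_act /sq_act /red !map_mxN linearN /= !mulNmx mulmxN.
by congr pair; rewrite opprD.
Qed.

Lemma pair_actMn X Y n p : pair_act (X *+ n) (Y *+ n) p = pair_act X Y p *+ n.
Proof.
elim: n => [|n IH]; first by rewrite !mulr0n pair_act0.
rewrite !mulrS -IH /pair_act /sq_act /red !map_mxD linearD /= !mulmxDl mulmxDr.
by congr pair; rewrite addrACA.
Qed.

Lemma pair_act_bracket X X' Y Y' p :
  pair_act (bracket X X') (bracket Y Y') p
  = pair_act X Y (pair_act X' Y' p) - pair_act X' Y' (pair_act X Y p).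
Proof.
rewrite /pair_act /sq_act /bracket /red !map_mxB !map_mxM linearB /= !trmx_mul.
congr pair; last by rewrite mulmxBl !mulmxA.
rewrite !mulmxBl !mulmxBr !mulmxDr !mulmxDl !mulmxA /=.
have cancel (a b c e u v : 'M[R]_4) :
    a - b + (c - e) = a + u + (v + c) - (b + v + (u + e)).
  by apply/matrixP=> i j; rewrite !mxE; ring.
exact: cancel.
Qed.

(** Commutation relations that hold in the spin lattice and in L hold for the
    action on pairs; this is how the two Chevalley bases are used together. *)
Lemma pair_act_comm X X' X'' Y Y' Y'' p :
  bracket X X' = X'' -> bracket Y Y' = Y'' ->
  pair_act X Y (pair_act X' Y' p)
  = pair_act X' Y' (pair_act X Y p) + pair_act X'' Y'' p.
Proof. by move=> <- <-; rewrite pair_act_bracket addrC subrK. Qed.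

End Pairs.

Lemma red_sq_act (R : comPzRingType) (A m : 'M[int]_4) :
  red R (sq_act A m) = sq_act (red R A) (red R m).
Proof. by rewrite /sq_act /red map_mxD !map_mxM map_trmx. Qed.

Lemma sq_actD (R : pzRingType) (A B m : 'M[R]_4) : sq_act (A + B) m = sq_act A m + sq_act B m.
Proof. by rewrite /sq_act linearD mulmxDl mulmxDr addrACA. Qed.

Lemma sq_actN (R : pzRingType) (A m : 'M[R]_4) : sq_act (- A) m = - sq_act A m.
Proof. by rewrite /sq_act linearN mulNmx mulmxN opprD. Qed.

Lemma sq_act_smx i j k l : (j < 4)%N -> (k < 4)%N -> (l < 4)%N ->
  sq_act (smx i j) (smx k l)
  = (if j == k then smx i l else 0) + (if l == j then smx k i else 0).
Proof. by move=> *; rewrite /sq_act smx_tr !mulmxE !smxM. Qed.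

Lemma sq_act_e00 :
  [/\ forall r, sq_act (dp spin (Pos r) 1) (smx 0 0) = 0,
      sq_act (coroot1 spin) (smx 0 0) = 0 &
      sq_act (coroot2 spin) (smx 0 0) = smx 0 0 *+ 2].
Proof.
split=> [[]||]; rewrite /= /spin_coroot1 /spin_coroot2 ?sq_actD ?sq_actN;
  by rewrite !sq_act_smx //= ?(oppr0, addr0).
Qed.

Section CyclicModule.
Variables (K : numFieldType) (L : B2_lattice 10) (v0 : 'cV[int]_10).
Hypothesis hv0 : highest_weight_vector L 0 2 v0.

Local Notation root_act r := (pair_act (dp spin r 1) (dp L r 1)).
Local Notation coroot1_act := (pair_act (coroot1 spin) (coroot1 L)).
Local Notation coroot2_act := (pair_act (coroot2 spin) (coroot2 L)).

(** Only the lowering operators of the simple roots are used to generate: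
    stability under the whole Lie algebra is the triangular decomposition
    argument of [cyclic_stable]. *)
Inductive cyclic_module : 'M[K]_4 * 'cV[K]_10 -> Prop :=
  | Cyclic_gen : cyclic_module (red K (smx 0 0), red K v0)
  | Cyclic_lin a p p' :
      cyclic_module p -> cyclic_module p' -> cyclic_module (a *: p + p')
  | Cyclic_f1 p : cyclic_module p -> cyclic_module (root_act (Neg A1) p)
  | Cyclic_f2 p : cyclic_module p -> cyclic_module (root_act (Neg A2) p).

Lemma cyclic0 : cyclic_module 0.
Proof. by have := Cyclic_lin (-1) Cyclic_gen Cyclic_gen; rewrite scaleN1r addNr. Qed.

Lemma cyclicZ a p : cyclic_module p -> cyclic_module (a *: p).
Proof. by move=> Ap; have := Cyclic_lin a Ap cyclic0; rewrite addr0. Qed.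

Lemma cyclicD p p' : cyclic_module p -> cyclic_module p' -> cyclic_module (p + p').
Proof. by move=> Ap Ap'; have := Cyclic_lin 1 Ap Ap'; rewrite scale1r. Qed.

Lemma cyclicN p : cyclic_module p -> cyclic_module (- p).
Proof. by rewrite -scaleN1r; exact: cyclicZ. Qed.

Lemma cyclicMn p n : cyclic_module p -> cyclic_module (p *+ n).
Proof. by rewrite -scaler_nat; exact: cyclicZ. Qed.

Lemma cyclic_divn p n : (0 < n)%N -> cyclic_module (p *+ n) -> cyclic_module p.
Proof.
move=> n0 /(cyclicZ (n%:R^-1 : K)); rewrite -[p *+ n]scaler_nat scalerA mulVf ?scale1r //.
by rewrite Num.Theory.pnatr_eq0 -lt0n.
Qed.

(** Raising and Cartan operators are moved to the right through the lowering
    operators until they reach the highest weight vectors. *)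
Lemma cyclic_stable p : cyclic_module p ->
  [/\ cyclic_module (coroot1_act p), cyclic_module (coroot2_act p),
      cyclic_module (root_act (Pos A1) p) & cyclic_module (root_act (Pos A2) p)].
Proof.
have [_ v0e v0h1 v0h2] := hv0.
have [e_v h1_v h2_v] := sq_act_e00.
have BS := dp_basis spin; have BL := dp_basis L.
have act_linear X Y a q q' : pair_act X Y (a *: q + q') = a *: pair_act X Y q + pair_act X Y q'
  := pair_act_linear X Y a q q'.
have act_gen X Y : pair_act X Y (red K (smx 0 0), red K v0)
    = (red K (sq_act X (smx 0 0)), red K (Y *m v0)).
  by rewrite /pair_act /= red_sq_act /red map_mxM.
have [hS1 hS2] := B2_coroots BS; have [hL1 hL2] := B2_coroots BL.
have [hS12 hS21] := B2_ef BS; have [hL12 hL21] := B2_ef BL.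
have [fS11 fS12 fS21 fS22] := B2_hf BS; have [fL11 fL12 fL21 fL22] := B2_hf BL.
elim=> {p} [|a p p' _ [h1 h2 e1 e2] _ [h1' h2' e1' e2']|p Ap [h1 h2 e1 e2]|p Ap [h1 h2 e1 e2]].
- have kill r : root_act (Pos r) (red K (smx 0 0), red K v0) = 0.
    by rewrite act_gen e_v v0e /red !map_mx0.
  rewrite !kill !act_gen h1_v h2_v v0h1 v0h2.
  rewrite scale0r /red !map_mx0 scaler_nat -/(red K _) -/(red K _).
  split; try exact: cyclic0.
  have -> : (red K (smx 0 0 *+ 2), red K (v0 *+ 2)) = (red K (smx 0 0), red K v0) *+ 2.
    by rewrite !mulr2n /red !map_mxD.
  exact/cyclicMn/Cyclic_gen.
- rewrite !act_linear.
  by split; exact: Cyclic_lin.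
- split.
  + rewrite (pair_act_comm _ fS11 fL11) pair_actN pair_actMn.
    by apply: cyclicD; [exact: Cyclic_f1 | apply/cyclicN/cyclicMn/Cyclic_f1].
  + rewrite (pair_act_comm _ fS21 fL21) pair_actMn.
    by apply: cyclicD; [exact: Cyclic_f1 | apply/cyclicMn/Cyclic_f1].
  + rewrite (pair_act_comm _ (esym hS1) (esym hL1)).
    by apply: cyclicD => //; exact: Cyclic_f1.
  + rewrite (pair_act_comm _ hS21 hL21) pair_act0 addr0.
    exact: Cyclic_f1.
- split.
  + rewrite (pair_act_comm _ fS12 fL12).
    by apply: cyclicD; exact: Cyclic_f2.
  + rewrite (pair_act_comm _ fS22 fL22) pair_actN pair_actMn.
    by apply: cyclicD; [exact: Cyclic_f2 | apply/cyclicN/cyclicMn/Cyclic_f2].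
  + rewrite (pair_act_comm _ hS12 hL12) pair_act0 addr0.
    exact: Cyclic_f2.
  + rewrite (pair_act_comm _ (esym hS2) (esym hL2)).
    by apply: cyclicD => //; exact: Cyclic_f2.
Qed.

(** The remaining root vectors are brackets of simple ones, up to the factor 2
    in the definition of the highest root vectors, invertible in K. *)
Lemma cyclic_root_act r p : cyclic_module p -> cyclic_module (root_act r p).
Proof.
have [eS eS' fS fS'] := B2_roots (dp_basis spin).
have [eL eL' fL fL'] := B2_roots (dp_basis L).
have eA1 q : cyclic_module q -> cyclic_module (root_act (Pos A1) q).
  by case/cyclic_stable.
have eA2 q : cyclic_module q -> cyclic_module (root_act (Pos A2) q).
  by case/cyclic_stable.
have cyclicB q q' : cyclic_module q -> cyclic_module q' -> cyclic_module (q - q').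
  by move=> Aq Aq'; apply: cyclicD => //; exact: cyclicN.
have eA12 q : cyclic_module q -> cyclic_module (root_act (Pos A12) q).
  move=> Aq; rewrite eS eL pair_act_bracket.
  by apply: cyclicB; [apply/eA1/eA2 | apply/eA2/eA1].
have fA12 q : cyclic_module q -> cyclic_module (root_act (Neg A12) q).
  move=> Aq; rewrite fS fL pair_act_bracket.
  by apply: cyclicB; [apply/Cyclic_f2/Cyclic_f1 | apply/Cyclic_f1/Cyclic_f2].
move=> Ap; case: r => -[].
- exact: eA1.
- exact: eA2.
- exact: eA12.
- apply: (@cyclic_divn _ 2) => //; rewrite -pair_actMn eS' eL' pair_act_bracket.
  by apply: cyclicB; [apply/eA12/eA2 | apply/eA2/eA12].
- exact: Cyclic_f1.
- exact: Cyclic_f2.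
- exact: fA12.
apply: (@cyclic_divn _ 2) => //; rewrite -pair_actMn fS' fL' pair_act_bracket.
by apply: cyclicB; [apply/Cyclic_f2/fA12 | apply/fA12/Cyclic_f2].
Qed.

(** The Cartan element on which both simple roots take the value 2; the highest
    weight 2 lambda_2 takes the value 6 on it. *)
Definition height : 'M[K]_10 := red K (coroot1 L *+ 4 + coroot2 L *+ 3).

(** [height_poly k] is the product of the factors h - (6 - 2 j), 1 <= j <= k: it
    kills the weight vectors of height 4, 2, ..., 6 - 2 k but no nonzero
    multiple of the highest weight vector. *)
Fixpoint height_poly (k : nat) (w : 'cV[K]_10) : 'cV[K]_10 :=
  if k is k'.+1 then height *m height_poly k' w - (6%:R - (k *+ 2)%:R) *: height_poly k' w
  else w.

Definition lower_weights (w : 'cV[K]_10) : Prop := exists k, height_poly k w = 0.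

Lemma height_poly_linear k : linear (height_poly k).
Proof.
elim: k => //= k IH a w w'; rewrite IH mulmxDr -scalemxAr !scalerDr !scalerN !scalerA.
rewrite (mulrC _ a) opprD addrACA; congr (_ + _).
Qed.

Lemma height_poly_eigen k c (w : 'cV[K]_10) :
  height *m w = c *: w ->
  height_poly k w = (\prod_(i < k) (c - (6%:R - (i.+1 *+ 2)%:R))) *: w.
Proof.
move=> hw; elim: k => [|k IH] /=; first by rewrite big_ord0 scale1r.
rewrite IH big_ord_recr /= -scalemxAr hw !scalerA -scalerBl; congr (_ *: _).
by ring.
Qed.

Lemma height_f (i : posroot) (w : 'cV[K]_10) : i = A1 \/ i = A2 ->
  height *m (red K (dp L (Neg i) 1) *m w)
  = red K (dp L (Neg i) 1) *m (height *m w) - 2%:R *: (red K (dp L (Neg i) 1) *m w).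
Proof.
have [f11 f12 f21 f22] := B2_hf (dp_basis L).
suff br : i = A1 \/ i = A2 -> 
    bracket (coroot1 L *+ 4 + coroot2 L *+ 3) (dp L (Neg i) 1) = - (dp L (Neg i) 1 *+ 2).
  move=> /br /(congr1 (fun A => red K A *m w)).
  rewrite /height /bracket /red map_mxB !map_mxM map_mxN mulmxBl !mulmxA => /eqP.
  rewrite subr_eq => /eqP ->; rewrite addrC mulNmx; congr (_ - _).
  by rewrite mulr2n map_mxD mulmxDl scaler_nat mulr2n.
have bD (A B D : 'M[int]_10) m n :
    bracket (A *+ m + B *+ n) D = bracket A D *+ m + bracket B D *+ n.
  rewrite /bracket !mulmxE mulrDl mulrDr !mulrnAl !mulrnAr !mulrnBl opprD.
  by rewrite addrACA.
rewrite bD; move: (dp L) f11 f12 f21 f22 => D f11 f12 f21 f22.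
by case=> ->; rewrite ?f11 ?f12 ?f21 ?f22; apply/matrixP=> a b; rewrite !mxE; ring.
Qed.

(** Since h f = f (h - 2), lowering shifts the roots of the polynomial by 2 and
    brings in the factor h - 6. *)
Lemma height_poly_f (i : posroot) k (w : 'cV[K]_10) : i = A1 \/ i = A2 ->
  height_poly k.+1 (red K (dp L (Neg i) 1) *m w)
  = red K (dp L (Neg i) 1) *m (height *m height_poly k w - 6%:R *: height_poly k w).
Proof.
move=> hi; elim: k => [|k IH].
  rewrite /= height_f // mulmxBr -!scalemxAr -addrA; congr (_ + _).
  by rewrite -scaleNr -scaleNr -scalerDl -scaleNr; congr (_ *: _); ring.
rewrite [LHS]/= -/(height_poly k.+1 _) IH.
set g := height_poly k w.
rewrite [height_poly k.+1 w]/= -/g height_f //.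
move: (red K (dp L _ _)) => f.
rewrite !scalemxAr -!mulmxBr; congr (_ *m _); rewrite !mulmxBr -!scalemxAr.
move: (height *m (height *m g)) (height *m g) => z t.
apply/matrixP=> a b; rewrite !mxE; ring.
Qed.

Lemma height_poly_vanish k j w : height_poly k w = 0 -> height_poly (j + k) w = 0.
Proof. by move=> h; elim: j => //= j ->; rewrite mulmx0 scaler0 subr0. Qed.

Lemma height_v0 : height *m red K v0 = 6%:R *: red K v0.
Proof.
have [_ _ v0h1 v0h2] := hv0.
rewrite /height -map_mxM mulmxDl -!(scaler_nat _ (coroot1 L)) -!(scaler_nat _ (coroot2 L)).
rewrite -!scalemxAl v0h1 v0h2 scale0r scaler0 add0r scalerA.
exact: (red_scale K (3 * 2)).
Qed.

Lemma lower_weights_lin a w w' :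
  lower_weights w -> lower_weights w' -> lower_weights (a *: w + w').
Proof.
move=> [k hk] [k' hk']; exists (k + k')%N.
by rewrite height_poly_linear (height_poly_vanish k hk') addnC (height_poly_vanish k' hk) scaler0 addr0.
Qed.

Lemma lower_weights_f i w : i = A1 \/ i = A2 ->
  lower_weights w -> lower_weights (red K (dp L (Neg i) 1) *m w).
Proof.
by move=> hi [k hk]; exists k.+1; rewrite height_poly_f // hk mulmx0 scaler0 subr0 mulmx0.
Qed.

Lemma lower_weights_f_v0 i : i = A1 \/ i = A2 ->
  lower_weights (red K (dp L (Neg i) 1) *m red K v0).
Proof. by move=> hi; exists 1%N; rewrite height_poly_f //= height_v0 subrr mulmx0. Qed.

Lemma v0_not_lower : ~ lower_weights (red K v0).
Proof.
move=> [k]; rewrite (height_poly_eigen _ height_v0) => /eqP; rewrite scaler_eq0.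
have [v0n0 _ _ _] := hv0.
case/orP=> [/eqP/eqP|/eqP].
  rewrite prodf_seq_eq0 => /hasP[j _ /=].
  by rewrite opprB addrC subrK Num.Theory.pnatr_eq0.
move=> v00; case/negP: v0n0; apply/eqP/matrixP=> i j.
move/matrixP/(_ i j): v00; rewrite !mxE => /eqP.
by rewrite intr_eq0 => /eqP.
Qed.

Lemma sq_act_simple00 (i : posroot) (m : 'M[K]_4) : i = A1 \/ i = A2 ->
  sq_act (red K (dp spin (Neg i) 1)) m (inord 0) (inord 0) = 0.
Proof.
move=> hi; rewrite /sq_act mxE [X in _ + X]mxE [X in X + _]mxE.
have row0 j : red K (dp spin (Neg i) 1) (inord 0) j = 0.
  case: hi => ->; by rewrite !mxE -!val_eqE /= !inordK.
rewrite big1 => [|j _]; last by rewrite row0 mul0r.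
by rewrite big1 ?addr0 // => j _; rewrite mxE row0 mulr0.
Qed.

(** Every element of the module is a multiple of the pair of highest weight
    vectors plus terms of lower weight, and the corner entry of the matrix reads
    off the multiple. *)
Lemma cyclic_lower p : cyclic_module p ->
  lower_weights (p.2 - p.1 (inord 0) (inord 0) *: red K v0).
Proof.
elim=> {p} [|a p p' _ IH _ IH'|p _ IH|p _ IH] /=.
- exists 0%N; rewrite /= !mxE eqxx.
  by rewrite scale1r subrr.
- have -> : a *: p.2 + p'.2 - (a *: p.1 + p'.1) (inord 0) (inord 0) *: red K v0
    = a *: (p.2 - p.1 (inord 0) (inord 0) *: red K v0)
      + (p'.2 - p'.1 (inord 0) (inord 0) *: red K v0).
    by apply/matrixP=> i j; rewrite !mxE; ring.
  exact: lower_weights_lin.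
- rewrite (sq_act_simple00 p.1 (or_introl erefl)) scale0r subr0.
  rewrite -[p.2](subrK (p.1 (inord 0) (inord 0) *: red K v0)) mulmxDr addrC -scalemxAr.
  by apply: lower_weights_lin; [apply: lower_weights_f_v0 | apply: lower_weights_f => //]; left.
- rewrite (sq_act_simple00 p.1 (or_intror erefl)) scale0r subr0.
  rewrite -[p.2](subrK (p.1 (inord 0) (inord 0) *: red K v0)) mulmxDr addrC -scalemxAr.
  by apply: lower_weights_lin; [apply: lower_weights_f_v0 | apply: lower_weights_f => //]; right.
Qed.

Hypothesis irrL : forall U : {vspace 'cV[K]_10},
  (forall (r : B2_root) (u : 'cV[K]_10), u \in U -> red K (dp L r 1) *m u \in U) ->
  U = 0%VS \/ U = fullv.

(** The module is the graph of a map: otherwise, by irreducibility, it contains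
    (0, v0), whose matrix has corner entry 0 although v0 is not of lower
    weight. *)
Lemma cyclic_functional w : cyclic_module (0, w) -> w = 0.
Proof.
pose N w := cyclic_module (0, w).
have N0 : N 0 by exact: cyclic0.
have Nlin a u v : N u -> N v -> N (a *: u + v).
  move=> Nu Nv; have := Cyclic_lin a Nu Nv; rewrite /N.
  suff -> : a *: ((0 : 'M[K]_4), u) + (0, v) = (0, a *: u + v) by [].
  by congr pair; rewrite /= scaler0 addr0.
have [U UN] := vspace_of_pred N0 Nlin.
have Ustable r u : u \in U -> red K (dp L r 1) *m u \in U.
  move=> /UN Nu; apply/UN; have := cyclic_root_act r Nu.
  by rewrite /pair_act /sq_act mulmx0 mul0mx addr0.
case: (irrL Ustable) => UE /UN; rewrite UE; first by rewrite memv0 => /eqP.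
have /UN/cyclic_lower/= : red K v0 \in U by rewrite UE memvf.
by rewrite mxE scale0r subr0 => /v0_not_lower.
Qed.

End CyclicModule.

(** * Symmetric matrices as a model of the Weyl lattice *)

(** The divided powers of [sq_act A] when A has square zero: the coefficients of
    t^k in (1 + t A) m (1 + t A)^T. *)
Definition sq_dp (R : pzRingType) (A : 'M[R]_4) (k : nat) (m : 'M[R]_4) : 'M[R]_4 :=
  match k with 0 => m | 1 => sq_act A m | 2 => A *m m *m A^T | _ => 0 end.

Lemma red_sq_dp (R : comPzRingType) (A m : 'M[int]_4) k :
  red R (sq_dp A k m) = sq_dp (red R A) k (red R m).
Proof.
case: k => [|[|[|k]]] //=; first exact: red_sq_act.
  by rewrite /red !map_mxM map_trmx.
by rewrite /red map_mx0.
Qed.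

Lemma sq_dp_linear (R : comPzRingType) (A : 'M[R]_4) k : linear (sq_dp A k).
Proof.
move=> a m m'; case: k => [|[|[|k]]] //=; rewrite ?scaler0 ?addr0 //.
  by rewrite /sq_act mulmxDr mulmxDl -scalemxAr -scalemxAl addrACA -scalerDr.
by rewrite mulmxDr mulmxDl -scalemxAr -scalemxAl.
Qed.

Lemma sq_dp_sym (R : comPzRingType) (A m : 'M[R]_4) k : m^T = m -> (sq_dp A k m)^T = sq_dp A k m.
Proof.
move=> ms; case: k => [|[|[|k]]] //=; rewrite ?trmx0 //.
  by rewrite /sq_act linearD /= !trmx_mul !trmxK ms addrC.
by rewrite !trmx_mul !trmxK ms mulmxA.
Qed.

Lemma iter_sq_act (R : comPzRingType) (A m : 'M[R]_4) k : A *m A = 0 ->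
  iter k (sq_act A) m = sq_dp A k m *+ k`!.
Proof.
move=> AA; have AtAt : A^T *m A^T = 0 by rewrite -trmx_mul AA trmx0.
have it2 : sq_act A (sq_act A m) = A *m m *m A^T *+ 2.
  rewrite /sq_act mulmxDr mulmxDl !mulmxA AA mul0mx add0r -(mulmxA m) AtAt mulmx0.
  by rewrite addr0 -mulr2n.
have it3 j : iter j.+3 (sq_act A) m = 0.
  elim: j => [|j IH]; last by rewrite iterS IH /sq_act mulmx0 mul0mx addr0.
  rewrite /= it2 /sq_act mulr2n mulmxDr mulmxDl !mulmxA AA -!(mulmxA _ A^T) AtAt.
  by rewrite !mul0mx mulmx0 !addr0.
by case: k => [|[|[|k]]] //; rewrite it3 mul0rn.
Qed.

Lemma iter_pair_act (R : comPzRingType) d (X : 'M[int]_4) (Y : 'M[int]_d) p k :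
  iter k (@pair_act R d X Y) p = (iter k (sq_act (red R X)) p.1, red R (Y ^+ k) *m p.2).
Proof.
elim: k => [|k IH]; first by case: p => m w; rewrite /= expr0 /red map_mx1 mul1mx.
by rewrite !iterS IH /pair_act /= exprS -mulmxE /red map_mxM mulmxA.
Qed.

Lemma spin_sqr (R : pzRingType) r : red R (dp spin r 1) *m red R (dp spin r 1) = 0.
Proof. by rewrite -map_mxM mulmxE spin_rootvec_sqr /red map_mx0. Qed.

Section Square.
Variables (L : B2_lattice 10) (v0 : 'cV[int]_10).
Hypothesis hL : weyl_lattice L 0 2 v0.

(** The integral form of [cyclic_module], generated by divided powers. *)
Inductive square_graph : 'M[int]_4 -> 'cV[int]_10 -> Prop :=
  | Square_gen : square_graph (smx 0 0) v0
  | Square_sub m w m' w' :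
      square_graph m w -> square_graph m' w' -> square_graph (m - m') (w - w')
  | Square_dp r k m w : square_graph m w ->
      square_graph (sq_dp (dp spin r 1) k m) (dp L r k *m w).

(** A divided power is a power divided by k!, and K has characteristic 0. *)
Lemma square_graph_cyclic (K : numFieldType) m w :
  square_graph m w -> cyclic_module L v0 (red K m, red K w).
Proof.
have [_ hv _] := hL.
elim=> {m w} [|m w m' w' _ IH _ IH'|r k m w _ IH]; first exact: Cyclic_gen.
- by have := cyclicD IH (cyclicN IH'); rewrite /red !map_mxB.
- apply: (@cyclic_divn _ _ _ _ k`!); first exact: fact_gt0.
  suff : cyclic_module L v0 (iter k (pair_act (dp spin r 1) (dp L r 1)) (red K m, red K w)).
    rewrite iter_pair_act dpE iter_sq_act ?spin_sqr // -red_sq_dp.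
    congr cyclic_module.
    have MnE (a : 'M[K]_4) (b : 'cV[K]_10) n : (a, b) *+ n = (a *+ n, b *+ n).
      by elim: n => // n IHn; rewrite !mulrS IHn.
    rewrite MnE; congr pair.
    by rewrite red_Mn -[LHS]/(_ *m red K w) -scaler_nat -scalemxAl scaler_nat /red map_mxM.
  elim: k => [//|k IHk]; rewrite iterS.
  exact: cyclic_root_act.
Qed.

Lemma square_graph_functional w : square_graph 0 w -> w = 0.
Proof.
have [[_ irrL] hv _] := hL.
move=> /(@square_graph_cyclic (complex Rdefinitions.R)); rewrite /red map_mx0.
move=> /(cyclic_functional hv irrL) w0.
by apply/matrixP=> i j; move/matrixP/(_ i j): w0; rewrite !mxE => /eqP; rewrite intr_eq0 => /eqP.
Qed.

Lemma square_graph_sym m w : square_graph m w -> m^T = m.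
Proof.
elim=> {m w} [|m w m' w' _ IH _ IH'|r k m w _ IH]; first exact: smx_tr.
  by rewrite linearB /= IH IH'.
exact: sq_dp_sym.
Qed.

(** By minimality of L: the vectors that occur form a sublattice containing v0
    and stable under all divided powers. *)
Lemma square_graph_onto w : exists m, square_graph m w.
Proof.
have [_ _ minL] := hL.
have := minL [set w | exists m, square_graph m w]%classic.
rewrite -[exists m, _]/([set w | exists m, square_graph m w]%classic w) => ->//.
- by exists (smx 0 0); exact: Square_gen.
- by move=> u v [m hm] [m' hm']; exists (m - m'); exact: Square_sub.
- by move=> r k v [m hm]; exists (sq_dp (dp spin r 1) k m); exact: Square_dp.
Qed.

End Square.

(** Coordinates on symmetric matrices: the k-th coordinate is the entry in row
    [pos_row]_k and column [pos_col]_k, and [pos_idx] is the inverse table,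
    extended symmetrically below the diagonal. *)
Definition pos_row : seq nat := [:: 0; 0; 0; 0; 1; 1; 1; 2; 2; 3]%N.
Definition pos_col : seq nat := [:: 0; 1; 2; 3; 1; 2; 3; 2; 3; 3]%N.
Definition pos_idx : seq (seq nat) :=
  [:: [:: 0; 1; 2; 3]; [:: 1; 4; 5; 6]; [:: 2; 5; 7; 8]; [:: 3; 6; 8; 9]]%N.

Definition vech (R : pzRingType) (m : 'M[R]_4) : 'cV[R]_10 :=
  \col_k m (inord (nth 0%N pos_row k)) (inord (nth 0%N pos_col k)).

Definition unvech (R : pzRingType) (c : 'cV[R]_10) : 'M[R]_4 :=
  \matrix_(i, j) c (inord (nth 0%N (nth [::] pos_idx i) j)) 0.

Lemma unvechK (R : pzRingType) (c : 'cV[R]_10) : vech (unvech c) = c.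
Proof.
apply/colP=> k; rewrite !mxE; congr (c _ 0).
by apply: val_inj; case: k => [[|[|[|[|[|[|[|[|[|[|//]]]]]]]]]] p]; rewrite /= !inordK.
Qed.

Lemma vechK (R : pzRingType) (m : 'M[R]_4) : m^T = m -> unvech (vech m) = m.
Proof.
move=> ms; have msE i j : m i j = m j i by rewrite -[in LHS]ms mxE.
apply/matrixP=> i j; rewrite !mxE.
by case: (ord4P i) => ->; case: (ord4P j) => ->; rewrite /= !inordK //= !inordK.
Qed.

Lemma vech_linear (R : pzRingType) : linear (@vech R).
Proof. by move=> a m m'; apply/colP=> k; rewrite !mxE. Qed.

Lemma unvech_linear (R : pzRingType) : linear (@unvech R).
Proof. by move=> a m m'; apply/matrixP=> i j; rewrite !mxE. Qed.

Lemma red_vech (R : pzRingType) m : red R (vech m) = vech (red R m).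
Proof. by apply/colP=> k; rewrite !mxE. Qed.

Lemma red_unvech (R : pzRingType) c : red R (unvech c) = unvech (red R c).
Proof. by apply/matrixP=> i j; rewrite !mxE. Qed.

Lemma unvech_delta (k : 'I_10) : unvech (delta_mx k 0) =
  let i := nth 0%N pos_row k in let j := nth 0%N pos_col k in
  if i == j then smx i i else smx i j + smx j i.
Proof.
apply/matrixP=> i j; rewrite !mxE eqxx andbT -val_eqE /=.
case: k => [[|[|[|[|[|[|[|[|[|[|//]]]]]]]]]] p] /=;
case: (ord4P i) => ->; case: (ord4P j) => ->;
by rewrite !mxE -?val_eqE /= !inordK // ?inordK.
Qed.

Section Square.
Variables (L : B2_lattice 10) (v0 : 'cV[int]_10).
Hypothesis hL : weyl_lattice L 0 2 v0.
Local Notation graph := (square_graph L v0).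

(** The squares of the basis spinors are reached from the highest weight vector
    by second divided powers, the mixed products from these by root vectors. *)
Lemma square_graph_basis (k : 'I_10) : exists w, graph (unvech (delta_mx k 0)) w.
Proof.
have g0 : graph (smx 0 0) v0 by exact: Square_gen.
have gN m : (exists w, graph (- m) w) -> exists w, graph m w.
  move=> [w h]; exists (w - w - w).
  have -> : m = - m - - m - - m by rewrite subrr sub0r opprK.
  by do 2?apply: Square_sub.
have step r k' m m' : (exists w, graph m w) -> sq_dp (spin_rootvec r) k' m = m' ->
    exists w, graph m' w.
  by move=> [w h] <-; exists (dp L r k' *m w); exact: Square_dp.
have g00 : exists w, graph (smx 0 0) w by exists v0.
have g11 : exists w, graph (smx 1 1) w.
  apply: (step (Neg A2) 2%N _ _ g00).
  by rewrite /= linearD /= !smx_tr !mulmxE !(mulrDl, mulrDr) !smxM //= ?(addr0, mul0r) ?smxM //= ?addr0.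
have g22 : exists w, graph (smx 2 2) w.
  apply: (step (Neg A12) 2%N _ _ g00).
  rewrite /= linearD linearN /= !smx_tr !mulmxE mulrBl !smxM // sub0r.
  by rewrite mulrBr !mulNr !smxM //= oppr0 add0r !opprK.
have g33 : exists w, graph (smx 3 3) w.
  apply: (step (Neg A122) 2%N _ _ g00).
  by rewrite /= linearN /= !smx_tr !mulmxE mulNr mulrN mulNr opprK !smxM.
rewrite unvech_delta; case: k => [[|[|[|[|[|[|[|[|[|[|//]]]]]]]]]] p] //=.
- apply: (step (Neg A2) 1%N _ _ g00).
  by rewrite /= sq_actD !sq_act_smx //= !addr0 addrC.
- apply: gN; apply: (step (Neg A12) 1%N _ _ g00).
  by rewrite /= sq_actD sq_actN !sq_act_smx //= !addr0 add0r addrC.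
- apply: gN; apply: (step (Neg A122) 1%N _ _ g00).
  by rewrite /= sq_actN !sq_act_smx //= addrC.
- apply: (step (Neg A1) 1%N _ _ g11).
  by rewrite /= !sq_act_smx //= addrC.
- apply: (step (Neg A12) 1%N _ _ g11).
  by rewrite /= sq_actD sq_actN !sq_act_smx //= !addr0 subr0 addrC.
- apply: (step (Neg A2) 1%N _ _ g22).
  by rewrite /= sq_actD !sq_act_smx //= !addr0 add0r addrC.
Qed.

(** Both lattices have rank 10, so the surjection of [square_graph_onto] is
    unimodular, which a homomorphism defined only over the complex numbers need
    not be; hence it stays invertible after reduction to any field. *)
Lemma square_iso_int : exists T : 'M[int]_10,
  [/\ T \in unitmx, T *m vech (smx 0 0) = v0 &
      forall r k c, dp L r k *m (T *m c)
        = T *m vech (sq_dp (dp spin r 1) k (unvech c))].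
Proof.
have [tau tauP] := fin_all_exists square_graph_basis.
pose T : 'M[int]_10 := \matrix_(i, k) tau k i 0.
have graphT c : graph (unvech c) (T *m c).
  elim/int_col_ind: c => [u v hu hv|k].
    have -> : unvech (u - v) = unvech u - unvech v by apply/matrixP=> i j; rewrite !mxE.
    by rewrite mulmxBr; exact: Square_sub.
  suff -> : T *m delta_mx k 0 = tau k by [].
  by rewrite -colE; apply/colP=> i; rewrite !mxE.
have graphE m w : graph m w -> w = T *m vech m.
  move=> h; apply/eqP; rewrite -subr_eq0; apply/eqP/(square_graph_functional hL).
  rewrite -(subrr m); apply: Square_sub => //.
  by rewrite -[X in graph X _](vechK (square_graph_sym h)).
have [S SP] : exists S : 'M[int]_10, T *m S = 1%:M.
  have ex (k : 'I_10) : exists c : 'cV[int]_10, T *m c = delta_mx k 0.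
    by have [m /graphE ->] := square_graph_onto hL (delta_mx k 0); exists (vech m).
  have [s sP] := fin_all_exists ex.
  exists (\matrix_(i, k) s k i 0); apply/matrixP=> i k.
  have := congr1 (fun c : 'cV_10 => c i 0) (sP k).
  rewrite !mxE eqxx andbT => <-.
  by apply: eq_bigr => j _; rewrite !mxE.
exists T; split.
- by have [] := mulmx1_unit SP.
- by rewrite -(graphE _ _ (Square_gen _ _)).
- by move=> r k c; apply/graphE/Square_dp.
Qed.

End Square.

Section FieldSquare.
Variables (F : fieldType) (L : B2_lattice 10) (v0 : 'cV[int]_10).
Hypothesis hL : weyl_lattice L 0 2 v0.

Lemma root_elt_spin r (t : F) : root_elt r t spin = 1%:M + t *: red F (dp spin r 1).
Proof.
rewrite /root_elt !big_ord_recl big_ord0 /= expr0 expr1 scale1r /red map_mx1.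
by rewrite !map_mx0 !scaler0 !addr0.
Qed.

(** The root element x acts on symmetric matrices by m |-> x m x^T; the right
    hand side is the root element of the symmetric square lattice. *)
Lemma root_elt_square r (t : F) (m : 'M[F]_4) :
  let x := root_elt r t spin in
  x *m m *m x^T = \sum_(k < 10) t ^+ k *: sq_dp (red F (dp spin r 1)) k m.
Proof.
rewrite /= root_elt_spin !big_ord_recl big_ord0.
set s := red F _; rewrite /= expr0 expr1 scale1r addr0 expr2.
rewrite linearD linearZ /= trmx1 mulmxDr mulmx1 mulmxDl mul1mx mulmxDl.
rewrite /sq_act scalerDr -!scalemxAl -!scalemxAr scalerA.
by rewrite !scaler0 !addr0 !addrA.
Qed.

Lemma square_iso : exists T : 'M[F]_10,
  [/\ T \in unitmx, T *m vech (red F (smx 0 0)) = red F v0 &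
      forall r t m, m^T = m -> root_elt r t L *m (T *m vech m)
        = T *m vech (root_elt r t spin *m m *m (root_elt r t spin)^T)].
Proof.
have [T [Tu Tv TL]] := square_iso_int hL.
exists (red F T); split.
- have TV := mulmxV Tu.
  have : red F T *m red F (invmx T) = 1%:M by rewrite -map_mxM TV /red map_mx1.
  by case/mulmx1_unit.
- by rewrite -red_vech -map_mxM Tv.
move=> r t m ms; rewrite root_elt_square /root_elt mulmx_suml.
have vech_sum (f : 'I_10 -> 'M[F]_4) : vech (\sum_k f k) = \sum_k vech (f k).
  by apply/colP=> i; rewrite !(mxE, summxE); apply: eq_bigr => k _; rewrite mxE.
rewrite vech_sum mulmx_sumr; apply: eq_bigr => k _.
have -> : vech (t ^+ k *: sq_dp (red F (dp spin r 1)) k m)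
    = t ^+ k *: vech (sq_dp (red F (dp spin r 1)) k m).
  by apply/colP=> i; rewrite !mxE.
rewrite -scalemxAl -scalemxAr -{2}(vechK ms); congr (_ *: _).
move: (vech m) => c; move: c; apply: linear_col_ext.
- by move=> a c c'; rewrite !mulmxDr -!scalemxAr.
- by move=> a c c'; rewrite unvech_linear sq_dp_linear vech_linear mulmxDr -scalemxAr.
move=> j; have -> : delta_mx j 0 = red F (delta_mx j 0 : 'cV[int]_10).
  by apply/colP=> i; rewrite !mxE; case: (_ && _).
by rewrite -red_unvech -red_sq_dp -red_vech -!map_mxM TL.
Qed.

End FieldSquare.

(** * The Clifford map and the spin group *)

Section Clifford.
Variable F : fieldType.
Implicit Types (v : 'cV[F]_5) (x : 'cV[F]_4).

(** The signs make the square of this matrix the scalar [nat5_form v] in every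
    characteristic and match the root vectors of [spin] and [nat5]. *)
Definition clifford v : 'M[F]_4 :=
  let c i := v (inord i) 0 in
  \matrix_(i, j) nth 0 (nth [::]
    [:: [:: - c 2%N; - c 1%N;   c 0%N;     0];
        [:: - c 3%N;   c 2%N;     0;   c 0%N];
        [::   c 4%N;     0;   c 2%N;   c 1%N];
        [::     0;   c 4%N;   c 3%N; - c 2%N]] i) j.

Lemma clifford_linear : linear clifford.
Proof.
move=> a v w; apply/matrixP=> i j; rewrite !mxE.
by case: (ord4P i) => ->; case: (ord4P j) => ->; rewrite !inordK //=; ring.
Qed.

Lemma clifford_sqr v : clifford v *m clifford v = (nat5_form v)%:M.
Proof.
apply/matrixP=> i j; rewrite mxE big_ord4 !mxE /nat5_form.
by case: (ord4P i) => ->; case: (ord4P j) => ->; rewrite inord_eq // !inordK //=; ring.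
Qed.

Lemma root_elt_nat5 r (t : F) :
  root_elt r t nat5 = 1%:M + t *: red F (nat5_rootvec r) + t ^+ 2 *: red F (nat5_halfsquare r).
Proof.
rewrite /root_elt !big_ord_recl big_ord0 /= expr0 expr1 scale1r /red !map_mx0.
by rewrite !scaler0 !addr0 addrA map_mx1.
Qed.

Definition spin_table (r : B2_root) (t : F) : seq (seq F) :=
  match r with
  | Pos A1   => [:: [:: 1; 0; 0; 0]; [:: 0; 1; t; 0]; [:: 0; 0; 1; 0]; [:: 0; 0; 0; 1]]
  | Pos A2   => [:: [:: 1; t; 0; 0]; [:: 0; 1; 0; 0]; [:: 0; 0; 1; t]; [:: 0; 0; 0; 1]]
  | Pos A12  => [:: [:: 1; 0; - t; 0]; [:: 0; 1; 0; t]; [:: 0; 0; 1; 0]; [:: 0; 0; 0; 1]]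
  | Pos A122 => [:: [:: 1; 0; 0; - t]; [:: 0; 1; 0; 0]; [:: 0; 0; 1; 0]; [:: 0; 0; 0; 1]]
  | Neg A1   => [:: [:: 1; 0; 0; 0]; [:: 0; 1; 0; 0]; [:: 0; t; 1; 0]; [:: 0; 0; 0; 1]]
  | Neg A2   => [:: [:: 1; 0; 0; 0]; [:: t; 1; 0; 0]; [:: 0; 0; 1; 0]; [:: 0; 0; t; 1]]
  | Neg A12  => [:: [:: 1; 0; 0; 0]; [:: 0; 1; 0; 0]; [:: - t; 0; 1; 0]; [:: 0; t; 0; 1]]
  | Neg A122 => [:: [:: 1; 0; 0; 0]; [:: 0; 1; 0; 0]; [:: 0; 0; 1; 0]; [:: - t; 0; 0; 1]]
  end.

Definition nat5_table (r : B2_root) (t : F) (a b c d e : F) : seq F :=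
  match r with
  | Pos A1   => [:: a + t * b; b; c; d - t * e; e]
  | Pos A2   => [:: a; b - 2 * t * c - t ^+ 2 * d; c + t * d; d; e]
  | Pos A12  => [:: a - 2 * t * c - t ^+ 2 * e; b; c + t * e; d; e]
  | Pos A122 => [:: a - t * d; b + t * e; c; d; e]
  | Neg A1   => [:: a; b + t * a; c; d; e - t * d]
  | Neg A2   => [:: a; b; c - t * b; d + 2 * t * c - t ^+ 2 * b; e]
  | Neg A12  => [:: a; b; c - t * a; d; e + 2 * t * c - t ^+ 2 * a]
  | Neg A122 => [:: a; b; c; d - t * a; e + t * b]
  end.

Lemma root_elt_spinE r (t : F) :
  root_elt r t spin = \matrix_(i, j) nth 0 (nth [::] (spin_table r t) i) j.
Proof.
rewrite root_elt_spin; apply/matrixP=> i j; case: r => -[];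
case: (ord4P i) => ->; case: (ord4P j) => ->; 
rewrite !mxE ?inord_eq // !inordK //=; ring.
Qed.

Lemma dmx_mul a b v : (b < 5)%N -> red F (dmx a b) *m v = v (inord b) 0 *: delta_mx (inord a) 0.
Proof.
move=> b5; apply/colP=> i; rewrite !mxE (bigD1 (inord b)) //= big1 => [|k kb]; last first.
  by rewrite !mxE (negPf kb) andbF mul0r.
by rewrite !mxE eqxx !andbT addr0 mulrC; case: (i == _).
Qed.

Lemma root_elt_nat5E r (t : F) v :
  root_elt r t nat5 *m v = \col_i nth 0 (nat5_table r t (v (inord 0) 0) (v (inord 1) 0)
    (v (inord 2) 0) (v (inord 3) 0) (v (inord 4) 0)) i.
Proof.
have redD (A B : 'M[int]_5) : red F (A + B) = red F A + red F B by rewrite /red map_mxD.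
have redN (A : 'M[int]_5) : red F (- A) = - red F A by rewrite /red map_mxN.
have red0 : red F (0 : 'M[int]_5) = 0 by rewrite /red map_mx0.
rewrite root_elt_nat5 !mulmxDl mul1mx -!scalemxAl.
case: r => -[]; rewrite /nat5_rootvec /nat5_halfsquare ?mulr2n ?redD ?redN ?redD ?red0
  ?mulmxDl ?mulNmx ?mulmxDl ?mul0mx ?dmx_mul //;
apply/colP; apply: ord5P; rewrite !mxE ?inord_eq // inordK //=; ring.
Qed.

(** Products of explicit 4 x 4 matrices are computed on tables of entries, so
    that [clifford_root_elt] reduces to identities between polynomials. *)
Definition mx4 (A : seq (seq F)) : 'M[F]_4 := \matrix_(i, j) nth 0 (nth [::] A i) j.

Definition mul_table (A B : seq (seq F)) : seq (seq F) :=
  let e i j := nth 0 (nth [::] A i) 0%N * nth 0 (nth [::] B 0%N) j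
    + nth 0 (nth [::] A i) 1%N * nth 0 (nth [::] B 1%N) j
    + nth 0 (nth [::] A i) 2%N * nth 0 (nth [::] B 2%N) j
    + nth 0 (nth [::] A i) 3%N * nth 0 (nth [::] B 3%N) j in
  [:: [:: e 0 0; e 0 1; e 0 2; e 0 3]; [:: e 1 0; e 1 1; e 1 2; e 1 3];
      [:: e 2 0; e 2 1; e 2 2; e 2 3]; [:: e 3 0; e 3 1; e 3 2; e 3 3]]%N.

Lemma mx4_mul A B : mx4 A *m mx4 B = mx4 (mul_table A B).
Proof.
apply/matrixP=> i j; rewrite mxE big_ord4 !mxE.
by case: (ord4P i) => ->; case: (ord4P j) => ->; rewrite !inordK.
Qed.

(** Clifford multiplication is equivariant: it intertwines the actions of the
    group on vectors and on spinors. *)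
Lemma clifford_root_elt r (t : F) v :
  root_elt r t spin *m clifford v = clifford (root_elt r t nat5 *m v) *m root_elt r t spin.
Proof.
rewrite root_elt_spinE root_elt_nat5E /clifford !mxE !inordK // -!/(mx4 _) !mx4_mul.
move: (v _ 0) (v (inord 1) 0) (v (inord 2) 0) (v (inord 3) 0) (v (inord 4) 0) => a b c d e.
case: r => -[]; rewrite /mul_table /=; congr mx4;
  congr [:: [:: _; _; _; _]; [:: _; _; _; _]; [:: _; _; _; _]; [:: _; _; _; _]]; ring.
Qed.
End Clifford.

Section Spin.
Variable F : fieldType.
Implicit Types (v : 'cV[F]_5) (x : 'cV[F]_4) (g : forall d, B2_lattice d -> 'M[F]_d).

Lemma root_elt_spinV r (t : F) : root_elt r t spin *m root_elt r (- t) spin = 1%:M.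
Proof.
rewrite !root_elt_spin mulmxDl mulmxDr mulmx1 mul1mx -scalemxAl mulmxDr mulmx1.
by rewrite -scalemxAr spin_sqr scaler0 addr0 scaleNr subrK.
Qed.

Lemma root_elt_nat5V r (t : F) : root_elt r t nat5 *m root_elt r (- t) nat5 = 1%:M.
Proof.
suff inv v : root_elt r t nat5 *m (root_elt r (- t) nat5 *m v) = v.
  apply/matrixP=> i j; have := congr1 (fun c : 'cV[F]_5 => c i 0) (inv (delta_mx j 0)).
  by rewrite mulmxA -colE !mxE eqxx andbT.
rewrite !root_elt_nat5E !mxE; apply/colP.
case: r => -[]; apply: ord5P; rewrite !mxE !inordK //=; ring.
Qed.

Lemma spin5_ind (P : (forall d, B2_lattice d -> 'M[F]_d) -> Prop) :
  P (fun d (_ : B2_lattice d) => 1) ->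
  (forall r t g, spin5 g -> P g -> P (fun d L => root_elt r t L *m g d L)) ->
  forall g, spin5 g -> P g.
Proof.
move=> P1 PM g [w ->]; elim: w => [|[r t] w IH].
  suff -> : (fun d (L : B2_lattice d) => \prod_(x <- [::]) root_elt x.1 x.2 L)
    = (fun d (L : B2_lattice d) => 1 : 'M[F]_d) by [].
  by apply/functional_extensionality_dep => d; apply/funext=> L; rewrite big_nil.
have -> : (fun d (L : B2_lattice d) => \prod_(x <- (r, t) :: w) root_elt x.1 x.2 L)
   = (fun d (L : B2_lattice d) => root_elt r t L *m \prod_(x <- w) root_elt x.1 x.2 L).
  by apply/functional_extensionality_dep => d; apply/funext=> L; rewrite big_cons mulmxE.
by apply: PM => //; exists w.
Qed.

Lemma spin5_root_mul r t g : spin5 g -> spin5 (fun d L => root_elt r t L *m g d L).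
Proof.
move=> [w ->]; exists ((r, t) :: w).
by apply/functional_extensionality_dep => d; apply/funext=> L; rewrite big_cons mulmxE.
Qed.

Lemma spin5_root r t : spin5 (fun d (L : B2_lattice d) => root_elt r t L : 'M[F]_d).
Proof.
exists [:: (r, t)].
by apply/functional_extensionality_dep => d; apply/funext=> L; rewrite big_seq1.
Qed.

Lemma spin5_clifford g v : spin5 g ->
  g 4%N spin *m clifford v = clifford (g 5%N nat5 *m v) *m g 4%N spin.
Proof.
move: g; apply: (@spin5_ind (fun g => g 4%N spin *m clifford v = clifford (g 5%N nat5 *m v) *m g 4%N spin)).
  by rewrite !mul1mx mulmx1.
by move=> r t g _ IH; rewrite -mulmxA IH mulmxA clifford_root_elt !mulmxA.
Qed.

Lemma spin5_unit g : spin5 g -> g 4%N spin \in unitmx /\ g 5%N nat5 \in unitmx.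
Proof.
move: g; apply: (@spin5_ind (fun g => g 4%N spin \in unitmx /\ g 5%N nat5 \in unitmx)).
  by rewrite !unitmx1.
move=> r t g _ [IH4 IH5]; rewrite !unitmx_mul IH4 IH5 !andbT.
by have [-> _] := mulmx1_unit (root_elt_spinV r t); have [-> _] := mulmx1_unit (root_elt_nat5V r t).
Qed.

Definition b0 : 'cV[F]_4 := delta_mx (inord 0) 0.

Lemma root_elt_spin_col r (t : F) x i : (i < 4)%N ->
  (root_elt r t spin *m x) (inord i) 0 =
  let s := nth [::] (spin_table r t) i in
  nth 0 s 0 * x (inord 0) 0 + nth 0 s 1 * x (inord 1) 0
  + nth 0 s 2 * x (inord 2) 0 + nth 0 s 3 * x (inord 3) 0.
Proof. by move=> i4; rewrite root_elt_spinE mxE big_ord4 !mxE !inordK. Qed.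

(** Spinors with nonzero first coordinate form the big cell, which is reached
    from [b0] by lowering root elements; one raising root element brings any
    other spinor into it. *)
Lemma spin5_transitive x : x != 0 ->
  exists g, spin5 g /\ exists2 c : F, c != 0 & g 4%N spin *m b0 = c *: x.
Proof.
have nz0 (y : 'cV[F]_4) : y (inord 0) 0 != 0 ->
    exists g, spin5 g /\ exists2 c : F, c != 0 & g 4%N spin *m b0 = c *: y.
  (* The product of the three factors maps b0 to
     b0 + a1 b1 - v b2 - (u + v a1) b3 when their parameters are a1, v, u. *)
  move=> y0; pose c := (y (inord 0) 0)^-1.
  pose a i := c * y (inord i) 0.
  exists (fun d L => root_elt (Neg A2) (a 1%N) L *m (root_elt (Neg A12) (- a 2%N) L *m
    root_elt (Neg A122) (a 1%N * a 2%N - a 3%N) L)); split.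
    by do 2!apply: spin5_root_mul; apply: spin5_root.
  exists c; first by rewrite invr_eq0.
  rewrite -!mulmxA; apply: col4P; rewrite !root_elt_spin_col //= !mxE !inord_eq //= -/(a _);
    rewrite ?mulr1n ?mulr0n /a; try ring.
  by rewrite !(mul1r, mul0r, addr0, mulr1, mulr0) mulVf.
move=> x0.
have [r [t rt]] : exists r (t : F), (root_elt r t spin *m x) (inord 0) 0 != 0.
  have [h0|h0] := eqVneq (x (inord 0) 0) 0; last first.
    by exists (Pos A1), 0; rewrite root_elt_spin_col //= !(mul0r, addr0, mul1r).
  have [h1|h1] := eqVneq (x (inord 1) 0) 0; last first.
    by exists (Pos A2), 1; rewrite root_elt_spin_col //= h0 !(mulr0, mul0r, add0r, addr0, mul1r).
  have [h2|h2] := eqVneq (x (inord 2) 0) 0; last first.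
    exists (Pos A12), 1; rewrite root_elt_spin_col //= h0 !(mulr0, mul0r, add0r, addr0, mul1r).
    by rewrite mulN1r oppr_eq0.
  have [h3|h3] := eqVneq (x (inord 3) 0) 0; last first.
    exists (Pos A122), 1; rewrite root_elt_spin_col //= h0 !(mulr0, mul0r, add0r, addr0, mul1r).
    by rewrite mulN1r oppr_eq0.
  by case/eqP: x0; apply: col4P; rewrite mxE.
have [g [sg [c c0 gc]]] := nz0 _ rt.
exists (fun d L => root_elt r (- t) L *m g d L); split; first exact: spin5_root_mul.
exists c => //; rewrite -mulmxA gc -scalemxAr mulmxA.
by have := root_elt_spinV r (- t); rewrite opprK => ->; rewrite mul1mx.
Qed.

End Spin.

(** * Points and lines of the dual polar space as spinors *)

Section Star.
Variables (F : fieldType) (P : 'M[F]_5).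
Implicit Types (v y : 'cV[F]_5) (x : 'cV[F]_4) (g : forall d, B2_lattice d -> 'M[F]_d).

Definition clifford_at x y : 'cV[F]_4 := clifford (invmx P *m y) *m x.

Lemma clifford_at_linear x : linear (clifford_at x).
Proof.
by move=> a y z; rewrite /clifford_at mulmxDr -scalemxAr clifford_linear mulmxDl -scalemxAl.
Qed.

HB.instance Definition _ x :=
  GRing.isLinear.Build F 'cV[F]_5 'cV[F]_4 *:%R (clifford_at x) (clifford_at_linear x).

(** The pure spinor correspondence: the vectors annihilating x, transported to
    the given quadratic space by P. *)
Definition star x : {vspace 'cV[F]_5} := lker (linfun (clifford_at x)).

Lemma mem_star x y : (y \in star x) = (clifford (invmx P *m y) *m x == 0).
Proof. by rewrite memv_ker lfunE. Qed.

Lemma starZ c x : c != 0 -> star (c *: x) = star x.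
Proof.
by move=> c0; apply/vspaceP=> y; rewrite !mem_star -scalemxAr scaler_eq0 (negPf c0).
Qed.

Hypothesis Pu : P \in unitmx.

Lemma mem_starP x v : (P *m v \in star x) = (clifford v *m x == 0).
Proof. by rewrite mem_star mulKmx. Qed.

Lemma act5_star g x : spin5 g -> act5 P g (star x) = star (g 4%N spin *m x).
Proof.
move=> sg; have [g4u g5u] := spin5_unit sg.
have E v : clifford (g 5%N nat5 *m v) *m (g 4%N spin *m x) = g 4%N spin *m (clifford v *m x).
  by rewrite !mulmxA spin5_clifford.
apply/vspaceP=> y; apply/idP/idP.
  case/memv_imgP=> z; rewrite mem_star => /eqP zx ->.
  by rewrite lfunE /= -!mulmxA mem_starP E zx mulmx0.
rewrite mem_star => /eqP yx.
apply/memv_imgP; exists (P *m (invmx (g 5%N nat5) *m (invmx P *m y))).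
  rewrite mem_starP; apply/eqP; rewrite -[LHS](mulKmx g4u) -E mulKVmx //.
  by rewrite yx mulmx0.
by rewrite lfunE /= -!mulmxA !(mulKmx Pu) mulKVmx // mulKVmx.
Qed.

Lemma dim_act5 g (X : {vspace 'cV[F]_5}) : spin5 g -> \dim (act5 P g X) = \dim X.
Proof.
move=> sg; have [_ g5u] := spin5_unit sg.
rewrite limg_dim_eq //; apply/eqP; rewrite -subv0; apply/subvP=> y.
rewrite memv_cap memv_ker lfunE /= memv0 => /andP[_ /eqP h].
have hu : P *m g 5%N nat5 *m invmx P \in unitmx by rewrite !unitmx_mul Pu g5u unitmx_inv.
by rewrite -[y](mulKmx hu) h mulmx0.
Qed.

Lemma clifford_col x v i : (i < 4)%N ->
  (clifford v *m x) (inord i) 0 =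
  nth 0 [:: - v (inord 2) 0 * x (inord 0) 0 - v (inord 1) 0 * x (inord 1) 0
             + v (inord 0) 0 * x (inord 2) 0;
            - v (inord 3) 0 * x (inord 0) 0 + v (inord 2) 0 * x (inord 1) 0
             + v (inord 0) 0 * x (inord 3) 0;
            v (inord 4) 0 * x (inord 0) 0 + v (inord 2) 0 * x (inord 2) 0
             + v (inord 1) 0 * x (inord 3) 0;
            v (inord 4) 0 * x (inord 1) 0 + v (inord 3) 0 * x (inord 2) 0
             - v (inord 2) 0 * x (inord 3) 0] i.
Proof.
rewrite mxE big_ord4 !mxE; case: i => [|[|[|[|//]]]] _; rewrite !inordK //=; ring.
Qed.

Lemma dim_star_b0 : \dim (star (b0 F)) = 2.
Proof.
pose p i : 'cV[F]_5 := P *m delta_mx (inord i) 0.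
have -> : star (b0 F) = <<[:: p 0%N; p 1%N]>>%VS.
  apply/vspaceP => y; rewrite span_cons span_seq1; apply/idP/idP; last first.
    case/memv_addP=> _ /vlineP[a ->] [_ /vlineP[b ->] ->].
    rewrite /p !scalemxAr -mulmxDr mem_starP; apply/eqP.
    apply: col4P; rewrite clifford_col //= !mxE ?inord_eq //=; ring.
  rewrite mem_star; set v := invmx P *m y => /eqP h.
  have -> : y = v (inord 0) 0 *: p 0%N + v (inord 1) 0 *: p 1%N.
    rewrite /p !scalemxAr -mulmxDr -[LHS](mulKVmx Pu) -/v; congr (_ *m _).
    have e i : (clifford v *m b0 F) (inord i) 0 = 0 by rewrite h mxE.
    have := e 0%N; have := e 1%N; have := e 2%N.
    rewrite !clifford_col //= !mxE !inord_eq //= !(mulr0, mulr1, addr0, subr0).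
    move=> v4 /eqP; rewrite oppr_eq0 => /eqP v3 /eqP; rewrite oppr_eq0 => /eqP v2.
    apply/colP; apply: ord5P; rewrite !mxE ?inord_eq //= ?v2 ?v3 ?v4; ring.
  by apply: memv_add; apply: memvZ; apply: memv_line.
apply/eqP; rewrite -[_ == _]/(free [:: p 0%N; p 1%N]); apply/freeP => k.
rewrite !big_ord_recl big_ord0 /= addr0 /p !scalemxAr -mulmxDr => h.
have {h} h : k ord0 *: delta_mx (inord 0) 0 + k (lift ord0 ord0) *: delta_mx (inord 1) 0 = 0 :> 'cV[F]_5.
  by rewrite -[LHS](mulKmx Pu) h mulmx0.
have h0 := congr1 (fun c : 'cV[F]_5 => c (inord 0) 0) h.
have h1 := congr1 (fun c : 'cV[F]_5 => c (inord 1) 0) h.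
move: h0 h1; rewrite !mxE !inord_eq //= !(mulr1, mulr0, addr0, add0r) => h0 h1.
by case=> [[|[|//]]] p2; [rewrite -[RHS]h0 | rewrite -[RHS]h1]; congr k; apply: val_inj.
Qed.

Lemma dim_star x : x != 0 -> \dim (star x) = 2.
Proof.
case/spin5_transitive=> g [sg [c c0 gc]].
by rewrite -(starZ x c0) -gc -act5_star // dim_act5 // dim_star_b0.
Qed.

Lemma star_b0_inj x : star x = star (b0 F) -> exists c, x = c *: b0 F.
Proof.
move=> h; exists (x (inord 0) 0).
have mem i : (i < 2)%N -> clifford (delta_mx (inord i) 0) *m x = 0.
  move=> i2; apply/eqP; rewrite -mem_starP h mem_starP; apply/eqP.
  by case: i i2 => [|[|//]] _; apply: col4P; rewrite clifford_col //= !mxE ?inord_eq //=; ring.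
have e i j : (i < 2)%N -> (clifford (delta_mx (inord i) 0) *m x) (inord j) 0 = 0.
  by move=> i2; rewrite mem // mxE.
have := e 0%N 0%N isT; have := e 0%N 1%N isT; have := e 1%N 0%N isT.
rewrite !clifford_col // /= !mxE !inord_eq //= !(oppr0, mul0r, mul1r, addr0, add0r, subr0).
move=> /eqP; rewrite oppr_eq0 => /eqP x1 x3 x2.
by apply: col4P; rewrite !mxE !inord_eq //= ?x1 ?x2 ?x3 ?mulr1 ?mulr0.
Qed.

(** By transitivity it suffices to recover [b0] from its annihilator. *)
Lemma star_inj x x' : x != 0 -> star x' = star x -> exists c, x' = c *: x.
Proof.
case/spin5_transitive=> g [sg [c c0 gc]] h; have [g4u g5u] := spin5_unit sg.
have [a ha] : exists a, invmx (g 4%N spin) *m x' = a *: b0 F.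
  apply: star_b0_inj; apply/vspaceP => y.
  have act_inj z : z \in act5 P g (star (b0 F)) = (z \in star x').
    by rewrite h act5_star // gc starZ.
  have im u : (linfun (mulmx (P *m g 5%N nat5 *m invmx P)) y \in act5 P g (star u)) = (y \in star u).
    rewrite act5_star // lfunE /= -!mulmxA mem_starP mem_star.
    have -> v : clifford (g 5%N nat5 *m v) *m (g 4%N spin *m u) = g 4%N spin *m (clifford v *m u).
      by rewrite !mulmxA spin5_clifford.
    by apply/eqP/eqP => [E|->]; rewrite ?mulmx0 // -[LHS](mulKmx g4u) E mulmx0.
  by rewrite -im act5_star // mulKVmx // -act_inj im.
exists (a * c); rewrite -scalerA -gc scalemxAr -ha mulKVmx //.
Qed.

Lemma clifford_polar v w : clifford v *m clifford w + clifford w *m clifford v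
  = (polar (@nat5_form F) v w)%:M.
Proof.
have cD (a b : 'cV[F]_5) : clifford (a + b) = clifford a + clifford b.
  by have := clifford_linear 1 a b; rewrite !scale1r.
have := clifford_sqr (v + w); rewrite cD mulmxDl !mulmxDr !clifford_sqr => h.
rewrite /polar !raddfB /= -h; move: (clifford v *m _) (clifford w *m _) => a b.
by apply/matrixP=> i j; rewrite !mxE; ring.
Qed.

Variable q : 'cV[F]_5 -> F.
Hypothesis hq : exists2 c : F, c != 0 & forall v, q (P *m v) = c * nat5_form v.

Lemma q_eq0 y : (q y == 0) = (nat5_form (invmx P *m y) == 0).
Proof.
by have [c c0 h] := hq; rewrite -{1}[y](mulKVmx Pu) h mulf_eq0 (negPf c0).
Qed.

Lemma star_totally_singular x : x != 0 -> totally_singular q (star x).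
Proof.
move=> x0 y; rewrite mem_star => /eqP h; apply/eqP; rewrite q_eq0.
have := clifford_sqr (invmx P *m y) => /(congr1 (fun A => A *m x)).
rewrite -mulmxA h mulmx0 mul_scalar_mx => /esym/eqP.
by rewrite scaler_eq0 (negPf x0) orbF.
Qed.

(** Two orthogonal singular vectors have anticommuting Clifford matrices of
    square zero, so these have a common kernel vector. *)
Lemma totally_singular_star X : \dim X = 2 -> totally_singular q X ->
  exists2 x, x != 0 & X = star x.
Proof.
move=> dX sX.
have sq0 y : y \in X -> nat5_form (invmx P *m y) = 0.
  by move=> /sX/eqP; rewrite q_eq0 => /eqP.
have nil y : y \in X -> clifford (invmx P *m y) *m clifford (invmx P *m y) = 0.
  by move=> Xy; rewrite clifford_sqr sq0 // -scalemx1 scale0r.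
have anti y z : y \in X -> z \in X -> clifford (invmx P *m y) *m clifford (invmx P *m z)
    = - (clifford (invmx P *m z) *m clifford (invmx P *m y)).
  move=> Xy Xz; apply/eqP; rewrite -addr_eq0 clifford_polar /polar -mulmxDr !sq0 ?memvD //.
  by rewrite !subr0 -scalemx1 scale0r.
pose y1 := (vbasis X)`_0; pose y2 := (vbasis X)`_1.
have Xy1 : y1 \in X by apply: vbasis_mem; rewrite mem_nth // size_tuple dX.
have Xy2 : y2 \in X by apply: vbasis_mem; rewrite mem_nth // size_tuple dX.
have b0n0 : b0 F != 0.
  apply/eqP=> /matrixP/(_ (inord 0) 0); rewrite !mxE !eqxx => /eqP; by rewrite oner_eq0.
have [w w0 y1w] : exists2 w : 'cV[F]_4, w != 0 & clifford (invmx P *m y1) *m w = 0.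
  have [E|E] := eqVneq (clifford (invmx P *m y1) *m b0 F) 0; first by exists (b0 F).
  by exists (clifford (invmx P *m y1) *m b0 F); rewrite // mulmxA nil // mul0mx.
have [x x0 [y1x y2x]] : exists2 x : 'cV[F]_4, x != 0 &
    clifford (invmx P *m y1) *m x = 0 /\ clifford (invmx P *m y2) *m x = 0.
  have [E|E] := eqVneq (clifford (invmx P *m y2) *m w) 0; first by exists w.
  exists (clifford (invmx P *m y2) *m w) => //.
  by rewrite !mulmxA nil // mul0mx anti // mulNmx -mulmxA y1w mulmx0 oppr0.
exists x => //; apply/eqP; rewrite eqEdim dim_star // dX leqnn andbT.
rewrite -(span_basis (vbasisP X)); apply/span_subvP => y.
have -> : vbasis X = [:: y1; y2] :> seq _.
  have : size (vbasis X) = 2 by rewrite size_tuple.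
  rewrite /y1 /y2.
  by case: (tval (vbasis X)) => [|? [|? []]].
by rewrite !inE => /orP[]/eqP->; rewrite mem_star ?y1x ?y2x.
Qed.

(** The symplectic form preserved by Spin(5) on spinors, in characteristic 2. *)
Definition sympl x (y : 'cV[F]_4) : F :=
  x (inord 0) 0 * y (inord 3) 0 + x (inord 3) 0 * y (inord 0) 0
  + (x (inord 1) 0 * y (inord 2) 0 + x (inord 2) 0 * y (inord 1) 0).

Lemma sympl_clifford v x (y : 'cV[F]_4) : 2%N \in [pchar F] ->
  sympl x (clifford v *m y) = sympl (clifford v *m x) y.
Proof.
move=> char2; have two : 2 = 0 :> F by exact: (pcharf0 char2).
rewrite /sympl !clifford_col //=.
apply/eqP; rewrite -subr_eq0; apply/eqP.
rewrite -[RHS](mul0r (v (inord 3) 0 * (x (inord 0) 0 * y (inord 2) 0 - x (inord 2) 0 * y (inord 0) 0)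
  + v (inord 1) 0 * (x (inord 1) 0 * y (inord 3) 0 - x (inord 3) 0 * y (inord 1) 0))) -two.
ring.
Qed.

(** If w has polar value 1 with v, then clifford v and clifford w satisfy
    c_v c_w + c_w c_v = 1 and c_v has square zero, so kernel and image of c_v
    agree.  They have dimension 2, and self-adjointness of c_v
    ([sympl_clifford]) makes them isotropic. *)
Lemma clifford_kernel v : 2%N \in [pchar F] -> v != 0 -> nat5_form v = 0 ->
  exists u1 u2 : 'cV[F]_4,
  [/\ forall x, clifford v *m x = 0 <-> exists s t, x = s *: u1 + t *: u2,
      forall s t, s *: u1 + t *: u2 = 0 -> s = 0 /\ t = 0 & sympl u1 u2 = 0].
Proof.
move=> char2 v0 qv.
have nil : clifford v *m clifford v = 0 by rewrite clifford_sqr qv -scalemx1 scale0r.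
have [w vw] : exists w, polar (@nat5_form F) v w = 1.
  have polarE w : polar (@nat5_form F) v w = v (inord 0) 0 * w (inord 4) 0
      + v (inord 4) 0 * w (inord 0) 0 + v (inord 1) 0 * w (inord 3) 0
      + v (inord 3) 0 * w (inord 1) 0 + 2 * v (inord 2) 0 * w (inord 2) 0.
    by rewrite /polar /nat5_form !mxE; ring.
  have pick i j : (j < 5)%N ->
      polar (@nat5_form F) v (delta_mx (inord j) 0) = v (inord i) 0 ->
      v (inord i) 0 != 0 -> exists w, polar (@nat5_form F) v w = 1.
    move=> j5 pj vi; exists ((v (inord i) 0)^-1 *: delta_mx (inord j) 0).
    by rewrite -(mulVf vi) -{3}pj !polarE !mxE; ring.
  have [h0|/(pick 0%N 4%N)] := eqVneq (v (inord 0) 0) 0; last first.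
    by apply=> //; rewrite polarE !mxE !inord_eq //=; ring.
  have [h1|/(pick 1%N 3%N)] := eqVneq (v (inord 1) 0) 0; last first.
    by apply=> //; rewrite polarE !mxE !inord_eq //=; ring.
  have [h3|/(pick 3%N 1%N)] := eqVneq (v (inord 3) 0) 0; last first.
    by apply=> //; rewrite polarE !mxE !inord_eq //=; ring.
  have [h4|/(pick 4%N 0%N)] := eqVneq (v (inord 4) 0) 0; last first.
    by apply=> //; rewrite polarE !mxE !inord_eq //=; ring.
  have h2 : v (inord 2) 0 = 0.
    by move/eqP: qv; rewrite /nat5_form h0 h1 !mul0r !add0r expf_eq0 => /eqP.
  by case/eqP: v0; apply/colP; apply: ord5P; rewrite mxE.
have split1 x : clifford v *m x = 0 -> x = clifford v *m (clifford w *m x).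
  move=> vx; have := clifford_polar v w; rewrite vw => /(congr1 (fun A => A *m x)).
  by rewrite mulmxDl -!mulmxA vx mulmx0 addr0 mul1mx => ->.
pose f : 'End('cV[F]_4) := linfun (mulmx (clifford v)).
have [u1 [u2 [uE uf]]] : exists u1 u2, (forall x, x \in lker f <-> exists s t, x = s *: u1 + t *: u2) /\
    (forall s t, s *: u1 + t *: u2 = 0 -> s = 0 /\ t = 0).
  apply: vspace_dim2.
  have E : lker f = limg f.
    apply/vspaceP=> x; apply/idP/idP.
      rewrite memv_ker lfunE /= => /eqP/split1 ->.
      by rewrite -[X in X \in _](lfunE (mulmx (clifford v))) memv_img ?memvf.
    by case/memv_imgP=> z _ ->; rewrite memv_ker !lfunE /= mulmxA nil mul0mx.
  have := limg_ker_dim f fullv; rewrite capfv -E dimvf /dim /= addnn -muln2.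
  by rewrite (_ : (4 * 1 = 2 * 2)%N) // => /eqP; rewrite eqn_pmul2r // => /eqP.
have ker x : clifford v *m x = 0 <-> exists s t, x = s *: u1 + t *: u2.
  by rewrite -uE memv_ker lfunE /=; split=> [->|/eqP].
exists u1, u2; split=> //.
have k1 : clifford v *m u1 = 0 by apply/ker; exists 1, 0; rewrite scale1r scale0r addr0.
have k2 : clifford v *m u2 = 0 by apply/ker; exists 0, 1; rewrite scale1r scale0r add0r.
rewrite (split1 u2 k2) sympl_clifford // k1 /sympl !mxE; ring.
Qed.

End Star.

(** * The Weyl embedding in spinor coordinates *)

Local Open Scope classical_set_scope.

Section Span1.
Variables (F : fieldType) (W : lmodType F).

Lemma span1Z (c : F) (w : W) : c != 0 -> span1 (c *: w) = span1 w.
Proof.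
move=> c0; apply/seteqP; split=> z [a _ <-].
  by exists (a * c); rewrite // scalerA.
by exists (a / c); rewrite // scalerA divfK.
Qed.

Lemma mem_span1 (w : W) : span1 w w.
Proof. by exists 1; rewrite // scale1r. Qed.

Definition conic_map (w0 w1 w2 : W) (z : 'cV[F]_3) : W :=
  z (inord 0) 0 *: w0 + z (inord 1) 0 *: w1 + z (inord 2) 0 *: w2.

Lemma conic_map_linear w0 w1 w2 : linear (conic_map w0 w1 w2).
Proof.
move=> a z z'; rewrite /conic_map !mxE !scalerDl !scalerDr !scalerA.
by rewrite [RHS]addrACA; congr (_ + _); exact: addrACA.
Qed.

HB.instance Definition _ w0 w1 w2 :=
  GRing.isLinear.Build F 'cV[F]_3 W *:%R (conic_map w0 w1 w2) (conic_map_linear w0 w1 w2).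
End Span1.

Section Embedding.
Variables (F : fieldType) (q : 'cV[F]_5 -> F) (P : 'M[F]_5).
Hypothesis charF : 2%N \in [pchar F].
Hypothesis hP : natural_identification q P.

Let Pu : P \in unitmx. Proof. by case: hP. Qed.
Let hq : exists2 c : F, c != 0 & forall v, q (P *m v) = c * nat5_form v.
Proof. by case: hP. Qed.

Lemma point_star (X : dps_point q) : exists2 x, x != 0 & sval X = star P x.
Proof. by case: X => X [dX sX]; exact: (totally_singular_star Pu hq dX sX). Qed.

Lemma star_point x : x != 0 -> exists X : dps_point q, sval X = star P x.
Proof.
move=> x0.
by exists (exist _ (star P x) (conj (dim_star Pu x0) (star_totally_singular Pu hq x0))).
Qed.

Section Weyl.
Variables (L : B2_lattice 10) (v0 : 'cV[int]_10) (T : 'M[F]_10).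
Hypothesis Tv : T *m vech (red F (smx 0 0)) = red F v0.
Hypothesis TL : forall r t m, m^T = m -> root_elt r t L *m (T *m vech m)
        = T *m vech (root_elt r t spin *m m *m (root_elt r t spin)^T).

Definition weyl_vector (x : 'cV[F]_4) : 'cV[F]_10 := T *m vech (x *m x^T).

Lemma weyl_vectorZ a x : weyl_vector (a *: x) = a ^+ 2 *: weyl_vector x.
Proof.
rewrite /weyl_vector linearZ /= -scalemxAl -scalemxAr scalerA -expr2.
have -> : vech (a ^+ 2 *: (x *m x^T)) = a ^+ 2 *: vech (x *m x^T).
  by apply/colP=> i; rewrite !mxE.
by rewrite -scalemxAr.
Qed.

Lemma spin5_weyl g x : spin5 g -> g 10%N L *m weyl_vector x = weyl_vector (g 4%N spin *m x).
Proof.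
move: g; apply: (@spin5_ind _ (fun g => g 10%N L *m weyl_vector x = weyl_vector (g 4%N spin *m x))).
  by rewrite !mul1mx.
move=> r t g _ IH; rewrite -mulmxA IH {1}/weyl_vector TL; last by rewrite trmx_mul trmxK.
by rewrite /weyl_vector -!mulmxA (trmx_mul (root_elt r t spin)) !mulmxA.
Qed.

Lemma weyl_vector_b0 : weyl_vector (b0 F) = red F v0.
Proof.
rewrite /weyl_vector -Tv; congr (_ *m vech _).
by rewrite /b0 trmx_delta mul_delta_mx red_delta.
Qed.

Variable X0 : dps_point q.
Hypothesis hX0 : stabilized_point P L v0 X0.

(** The positive root elements fix the highest weight vector, hence the spinor
    of X0 up to a scalar; only multiples of [b0] are such common eigenvectors. *)
Lemma stabilized_point_star : sval X0 = star P (b0 F).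
Proof.
have [x x0 hx] := point_star X0.
have fix_b0 r : root_elt (Pos r) (1 : F) spin *m b0 F = b0 F.
  by case: r; apply: col4P; rewrite root_elt_spin_col //= !mxE !inord_eq //=; ring.
have stab r : exists c, root_elt (Pos r) 1 spin *m x = c *: x.
  apply: (star_inj Pu x0).
  have sg := spin5_root (Pos r) (1 : F).
  have := hX0 sg; rewrite hx act5_star // => -> //.
  by rewrite /act_v0 -weyl_vector_b0 spin5_weyl // fix_b0.
have coords r c : root_elt (Pos r) 1 spin *m x = c *: x -> forall i, (i < 4)%N ->
   let s := nth [::] (spin_table (Pos r) 1) i in
   nth 0 s 0 * x (inord 0) 0 + nth 0 s 1 * x (inord 1) 0
    + nth 0 s 2 * x (inord 2) 0 + nth 0 s 3 * x (inord 3) 0 = c * x (inord i) 0.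
  by move=> h i i4; have := root_elt_spin_col (Pos r) 1 x i4; rewrite h mxE => ->.
(* A coordinate b fixed by the root element forces the eigenvalue c to be 1,
   so the coordinate a to which b is added cannot change. *)
have cancel1 (c a b : F) : b != 0 -> b = c * b -> a + b = c * a -> False.
  move=> bn0 /eqP; rewrite -{1}[b]mul1r => /eqP/(mulIf bn0) <-; rewrite mul1r => /eqP.
  by rewrite -subr_eq0 addrAC subrr add0r (negPf bn0).
have x3 : x (inord 3) 0 = 0.
  apply/eqP; apply: contraT => xn; have [c /coords h] := stab A122.
  have := h 0%N isT; have := h 3%N isT; rewrite /= !(mul0r, mul1r, add0r, addr0) mulN1r => h3 h0.
  by exfalso; apply: (@cancel1 c (x (inord 0) 0) (- x (inord 3) 0)); rewrite ?oppr_eq0 // mulrN -h3.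
have x2 : x (inord 2) 0 = 0.
  apply/eqP; apply: contraT => xn; have [c /coords h] := stab A12.
  have := h 0%N isT; have := h 2%N isT; rewrite /= !(mul0r, mul1r, add0r, addr0) mulN1r => h3 h0.
  by exfalso; apply: (@cancel1 c (x (inord 0) 0) (- x (inord 2) 0)); rewrite ?oppr_eq0 // mulrN -h3.
have x1 : x (inord 1) 0 = 0.
  apply/eqP; apply: contraT => xn; have [c /coords h] := stab A2.
  have := h 0%N isT; have := h 1%N isT; rewrite /= !(mul0r, mul1r, add0r, addr0) => h3 h0.
  by exfalso; apply: (@cancel1 c (x (inord 0) 0) (x (inord 1) 0)).
have xE : x = x (inord 0) 0 *: b0 F.
  by apply: col4P; rewrite !mxE !inord_eq //= ?x1 ?x2 ?x3; ring.
rewrite hx xE starZ //; apply: contraNneq x0 => h; by rewrite xE h scale0r.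
Qed.

(** Elements g with g X0 = X map [b0] to multiples of x, and at least one such g
    exists by transitivity, so the union in the definition is a single point. *)
Lemma weyl_embeddingE X x : x != 0 -> sval X = star P x ->
  weyl_embedding P L v0 X0 X = span1 (weyl_vector x).
Proof.
move=> x0 hX; rewrite /weyl_embedding stabilized_point_star hX.
have act_v0E g : spin5 g -> act_v0 L v0 g = span1 (weyl_vector (g 4%N spin *m b0 F)).
  by move=> sg; rewrite /act_v0 -weyl_vector_b0 spin5_weyl.
apply/seteqP; split=> [w [g [sg]]|w hw].
  rewrite act5_star // act_v0E //= => /(star_inj Pu x0) [c hc].
  have c0 : c != 0.
    have [g4u _] := spin5_unit sg.
    apply: contra_eq_neq hc => ->; rewrite scale0r.
    apply/eqP => /(congr1 (mulmx (invmx (g 4%N spin)))); rewrite mulKmx // mulmx0.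
    by move=> /matrixP/(_ (inord 0) 0); rewrite !mxE !eqxx => /eqP; rewrite oner_eq0.
  by rewrite hc weyl_vectorZ span1Z // expf_neq0.
have [g [sg [c c0 hc]]] := spin5_transitive x0.
exists g; first by split; rewrite // act5_star // hc starZ.
by rewrite act_v0E // hc weyl_vectorZ span1Z // expf_neq0.
Qed.

End Weyl.

(** * Veronesean embeddings from quadratic maps *)

(** Criterion for x |-> <Phi x> to be a veronesean embedding: Phi lies over the
    Veronese map via [pi], and it is a quadratic map on isotropic planes.  The
    projection [pi] takes care of injectivity and of the independence of points
    and lines, the restriction to isotropic planes of the conics. *)
Section General.
Variables (W : lmodType F) (Phi : 'cV[F]_4 -> W) (pi : {linear W -> 'M[F]_4}).
Hypothesis PhiZ : forall a x, Phi (a *: x) = a ^+ 2 *: Phi x.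
Hypothesis piPhi : forall x, pi (Phi x) = x *m x^T.
Hypothesis Phi_line : forall u1 u2, sympl u1 u2 = 0 ->
  exists w, forall s t, Phi (s *: u1 + t *: u2) = s ^+ 2 *: Phi u1 + (s * t) *: w + t ^+ 2 *: Phi u2.
Hypothesis Phi_span : forall U : set W, subspace U -> (forall x, U (Phi x)) -> U = setT.
Variable eps : dps_point q -> set W.
Hypothesis epsE : forall X x, x != 0 -> sval X = star P x -> eps X = span1 (Phi x).

Lemma outer_eq0 (x : 'cV[F]_4) (y : 'cV[F]_4) : y != 0 -> x *m y^T = 0 -> x = 0.
Proof.
move=> y0 xy; apply/eqP; apply: contraNT y0 => x0; apply/eqP.
have [i xi] : exists i, x i 0 != 0.
  apply/existsP; apply: contraT => /existsPn h; case/eqP: x0; apply/colP=> i.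
  by have := h i; rewrite negbK mxE => /eqP.
apply/colP=> j; have := congr1 (fun A : 'M[F]_4 => A i j) xy.
by rewrite !mxE big_ord1 mxE => /eqP; rewrite mulf_eq0 (negPf xi) => /eqP.
Qed.

Lemma Phi_neq0 x : x != 0 -> Phi x != 0.
Proof.
move=> x0; apply: contraNneq x0 => h; have := piPhi x; rewrite h linear0 => /esym xx.
by apply/eqP; apply: contrapT => /eqP x0; have := outer_eq0 x0 xx; apply/eqP.
Qed.

Lemma span1_Phi_inj x x' : x != 0 -> x' != 0 -> span1 (Phi x) = span1 (Phi x') ->
  exists2 c, c != 0 & x' = c *: x.
Proof.
move=> x0 x'0 h.
have [a _ ha] : span1 (Phi x) (Phi x') by rewrite h; exact: mem_span1.
have := congr1 pi ha; rewrite linearZ /= !piPhi => xx.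
have [j xj] : exists j, x' j 0 != 0.
  apply/existsP; apply: contraT => /existsPn h'; case/eqP: x'0; apply/colP=> i.
  by have := h' i; rewrite negbK mxE => /eqP.
have E : x' = (a * x j 0 / x' j 0) *: x.
  apply/colP=> i; have := congr1 (fun A : 'M[F]_4 => A i j) xx.
  rewrite !mxE !big_ord1 !mxE => e; apply: (mulIf xj).
  by rewrite -e; field.
exists (a * x j 0 / x' j 0) => //.
by apply: contraNneq x'0 => h'; rewrite E h' scale0r.
Qed.

Lemma line_kernel (l : set (dps_point q)) : dps_line l ->
  exists v : 'cV[F]_5, [/\ v != 0, nat5_form v = 0 &
    forall X x, sval X = star P x -> l X <-> clifford v *m x = 0].
Proof.
move=> [X [dX sX ->]].
have [y y0 XE] : exists2 y, y != 0 & X = <[y]>%VS.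
  exists (vpick X); first by rewrite vpick0 -dimv_eq0 dX.
  apply/eqP; rewrite eq_sym eqEdim dX dim_vline vpick0 -dimv_eq0 dX /= andbT.
  by rewrite -memvE memv_pick.
exists (invmx P *m y); split.
- by apply: contraNneq y0 => h; rewrite -[y](mulKVmx Pu) h mulmx0.
- by apply/eqP; rewrite -(q_eq0 Pu hq) sX // XE memv_line.
- by move=> Y x hY; rewrite /= hY XE -memvE mem_star; split=> [/eqP|->].
Qed.

Definition conic_form (z : 'cV[F]_3) : F :=
  z (inord 0) 0 * z (inord 2) 0 - z (inord 1) 0 ^+ 2.

Lemma conic_form_nonsingular : nonsingular_form conic_form.
Proof.
have polarE x y : polar conic_form x y = x (inord 0) 0 * y (inord 2) 0
    + y (inord 0) 0 * x (inord 2) 0 - 2 * x (inord 1) 0 * y (inord 1) 0.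
  by rewrite /polar /conic_form !mxE; ring.
split=> [|x qx rad]; first split=> [a x|a x y z].
- by rewrite /conic_form !mxE; ring.
- by rewrite !polarE !mxE; ring.
have x0 := rad (delta_mx (inord 2) 0); have x2 := rad (delta_mx (inord 0) 0).
move: x0 x2 qx; rewrite !polarE /conic_form !mxE !inord_eq //=.
rewrite !(mulr0, mulr1, mul0r, mul1r, addr0, add0r, subr0) => x0 x2.
rewrite x0 mul0r sub0r => /eqP; rewrite oppr_eq0 expf_eq0 => /eqP x1.
by apply: col3P; rewrite mxE.
Qed.

(** The conic of the line ker (clifford v) is the image of z_0 z_2 = z_1^2, with
    z = (s^2, s t, t^2) on the spinor s u1 + t u2.  A point x off that line is
    separated from the span of the line by the condition
    clifford v *m pi w = 0, which cuts out a subspace containing the line. *)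
Lemma veronesean_of_quadratic : veronesean_embedding (G := dual_polar_space q) eps.
Proof.
split.
- move=> X; have [x x0 hX] := point_star X.
  by exists (Phi x); [exact: Phi_neq0 | exact: epsE].
- move=> X X'; have [x x0 hX] := point_star X; have [x' x'0 hX'] := point_star X'.
  rewrite (epsE x0 hX) (epsE x'0 hX') => /(span1_Phi_inj x0 x'0)[c c0 E].
  have : sval X = sval X' by rewrite hX hX' E starZ.
  by case: X {hX} => [X pX]; case: X' {hX'} => [X' pX'] /=; apply: eq_exist.
- move=> l /line_kernel [v [v0 qv lE]].
  have [u1 [u2 [ker free u12]]] := clifford_kernel charF v0 qv.
  have [w hw] := Phi_line u12.
  have piw : pi w = u1 *m u2^T + u2 *m u1^T.
    have := congr1 pi (hw 1 1); rewrite !expr1n mulr1 !scale1r !linearD /= !piPhi.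
    rewrite linearD /= mulmxDl !mulmxDr => h; apply/eqP; rewrite -subr_eq0; apply/eqP.
    move: h; move: (u1 *m u1^T) (u1 *m u2^T) (u2 *m u1^T) (u2 *m u2^T) (pi w) => a b c d e.
    move=> /eqP; rewrite -subr_eq0 => /eqP h; rewrite -oppr0 -h.
    by apply/matrixP=> i j; rewrite !mxE; ring.
  have outer2 (a b : 'cV[F]_4) : a *m u1^T + b *m u2^T = 0 -> a = 0 /\ b = 0.
    move=> h; suff H i : a i 0 = 0 /\ b i 0 = 0.
      by split; apply/colP=> i; rewrite mxE; case: (H i).
    apply: free; apply/colP=> j; have := congr1 (fun A : 'M[F]_4 => A i j) h.
    by rewrite !mxE !big_ord1 !mxE.
  exists (conic_map (Phi u1) w (Phi u2)), conic_form; split.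
  + apply: raddf_inj => z; rewrite /= /conic_map => /(congr1 pi).
    rewrite linear0 !linearD !linearZ /= !piPhi piw => h.
    have [h1 h2] : z (inord 0) 0 *: u1 + z (inord 1) 0 *: u2 = 0 /\
                   z (inord 1) 0 *: u1 + z (inord 2) 0 *: u2 = 0.
      apply: outer2; rewrite -h !mulmxDl -!scalemxAl scalerDr.
      by rewrite -!addrA; congr (_ + _); rewrite addrCA.
    have [z0 z1] := free _ _ h1; have [_ z2] := free _ _ h2.
    by apply: col3P; rewrite mxE.
  + exact: conic_form_nonsingular.
  + apply/seteqP; split=> A.
      case=> X lX <-; have [x x0 hX] := point_star X.
      move: lX; rewrite (lE X x hX) (epsE x0 hX) => /ker [s [t xE]].
      exists (s ^+ 2 *: delta_mx (inord 0) 0 + (s * t) *: delta_mx (inord 1) 0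
              + t ^+ 2 *: delta_mx (inord 2) 0); last first.
        rewrite /= /conic_map !mxE !inord_eq //= !(mulr0, mulr1, addr0, add0r).
        by rewrite xE hw.
      split; last by rewrite /conic_form !mxE !inord_eq //=; ring.
      apply: contraNneq x0 => h.
      have h0 := congr1 (fun c : 'cV[F]_3 => c (inord 0) 0) h.
      have h2 := congr1 (fun c : 'cV[F]_3 => c (inord 2) 0) h.
      move: h0 h2; rewrite !mxE !inord_eq //= !(mulr0, mulr1, addr0, add0r).
      move=> /eqP; rewrite expf_eq0 => /eqP s0 /eqP; rewrite expf_eq0 => /eqP t0.
      by rewrite xE s0 t0 !scale0r addr0.
    case=> z [zn0 qz] <-.
    (* Any zero z of the conic form is proportional to (s^2, s t, t^2). *)
    have [s [t [c [c0 st0 zE]]]] : exists s t c, [/\ c != 0, ~ (s = 0 /\ t = 0) &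
        conic_map (Phi u1) w (Phi u2) z = c *: Phi (s *: u1 + t *: u2)].
      move/eqP: qz; rewrite /conic_form subr_eq0 => /eqP qz.
      have [z0|z0] := eqVneq (z (inord 0) 0) 0.
        have z1 : z (inord 1) 0 = 0.
          by move/esym/eqP: qz; rewrite z0 mul0r expf_eq0 => /eqP.
        exists 0, 1, (z (inord 2) 0); split.
        - by apply: contraNneq zn0 => z2; apply/eqP/col3P; rewrite mxE.
        - by case=> _ /eqP; rewrite oner_eq0.
        - by rewrite /conic_map z0 z1 scale0r add0r scale1r !scale0r !add0r.
      exists (z (inord 0) 0), (z (inord 1) 0), (z (inord 0) 0)^-1; split.
      - by rewrite invr_eq0.
      - by case=> h _; rewrite h eqxx in z0.
      - by rewrite hw !scalerDr !scalerA -qz expr2 !mulKf.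
    have x0 : s *: u1 + t *: u2 != 0 by apply/eqP => /free.
    have [X hX] := star_point x0; exists X.
      by apply/(lE X _ hX)/ker; exists s, t.
    by rewrite (epsE x0 hX) /= zE span1Z.
- move=> X l /line_kernel [v [v0 qv lE]] lX; have [x x0 hX] := point_star X.
  rewrite (epsE x0 hX); apply/seteqP; split=> [w [[a _ <-] aw]|w ->]; last first.
    split; first by exists 0; rewrite // scale0r.
    by move=> U [[U0 _] _].
  have : clifford v *m pi (a *: Phi x) = 0.
    apply: (aw [set w | clifford v *m pi w = 0]); split.
      split=> [|b u u' /= hu hu']; first by rewrite /= linear0 mulmx0.
      by rewrite linearP mulmxDr -scalemxAr hu hu' scaler0 addr0.
    move=> u [Y lY]; have [y y0 hY] := point_star Y.
    rewrite (epsE y0 hY) => -[b _ <-] /=.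
    by rewrite linearZ /= piPhi -scalemxAr mulmxA ((lE Y y hY).1 lY) mul0mx scaler0.
  rewrite linearZ /= piPhi -scalemxAr mulmxA => /eqP; rewrite scaler_eq0.
  case/orP=> [/eqP->|/eqP/(outer_eq0 x0)/(lE X x hX) //].
  by rewrite scale0r.
- apply: Phi_span.
    split=> [U [[]] //|a u u' hu hu' U hU].
    by have [[_ Ulin] _] := hU; apply: Ulin; [apply: hu | apply: hu'].
  move=> x U [[U0 Ulin] hU].
  have [->|x0] := eqVneq x 0.
    by have := PhiZ 0 0; rewrite expr0n /= !scale0r => ->.
  have [X hX] := star_point x0; apply: hU; exists X => //.
  by rewrite (epsE x0 hX); exact: mem_span1.
Qed.

End General.
End Embedding.

(** * The larger embedding *)

(** The scalar field with a acting as multiplication by a^2; additivity of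
    squaring, hence [charF], is needed for the module axioms. *)
Definition frobenius_twist (F : fieldType) (charF : 2%N \in [pchar F]) : Type := F.

Section Twist.
Variables (F : fieldType) (charF : 2%N \in [pchar F]).
Local Notation F' := (frobenius_twist charF).

HB.instance Definition _ := GRing.Zmodule.copy F' F.

Definition twist_scale (a : F) (b : F') : F' := a ^+ 2 * b.

Lemma char2_sqrD (a b : F) : (a + b) ^+ 2 = a ^+ 2 + b ^+ 2.
Proof. by rewrite sqrrD -mulr_natr (pcharf0 charF) mulr0 addr0. Qed.

Lemma twist_scaleA a b (v : F') : twist_scale a (twist_scale b v) = twist_scale (a * b) v.
Proof. by rewrite /twist_scale mulrA exprMn. Qed.
Lemma twist_scale1 : left_id 1 twist_scale.
Proof. by move=> v; rewrite /twist_scale expr1n mul1r. Qed.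
Lemma twist_scaleDr : right_distributive twist_scale +%R.
Proof. by move=> a u v; exact: mulrDr. Qed.
Lemma twist_scaleDl (v : F') : {morph twist_scale^~ v : a b / a + b}.
Proof. by move=> a b; rewrite /twist_scale char2_sqrD; exact: mulrDl. Qed.

HB.instance Definition _ := GRing.Zmodule_isLmodule.Build F F'
  twist_scaleA twist_scale1 twist_scaleDr twist_scaleDl.

(** In characteristic 2 this quadratic form polarizes to [sympl]. *)
Definition sp_form (x : 'cV[F]_4) : F :=
  x (inord 0) 0 * x (inord 3) 0 + x (inord 1) 0 * x (inord 2) 0.

Definition quartic_coord (x : 'cV[F]_4) : F' := x (inord 0) 0 ^+ 2 * sp_form x.

Lemma sp_form_lin s t u1 u2 : sympl u1 u2 = 0 ->
  sp_form (s *: u1 + t *: u2) = s ^+ 2 * sp_form u1 + t ^+ 2 * sp_form u2.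
Proof.
move=> u12; rewrite -[RHS]addr0 -(mulr0 (s * t)) -u12 /sp_form /sympl !mxE; ring.
Qed.

Section Weyl.
Variables (T : 'M[F]_10) (Tu : T \in unitmx).
Local Notation ver := (weyl_vector T).

Lemma weyl_vectorE (x y : 'cV[F]_4) s t : ver (s *: x + t *: y) =
  s ^+ 2 *: ver x + (s * t) *: (T *m vech (x *m y^T + y *m x^T)) + t ^+ 2 *: ver y.
Proof.
rewrite /weyl_vector !scalemxAr -!mulmxDr; congr (_ *m _).
apply/colP=> i; rewrite !mxE !big_ord1 !mxE; ring.
Qed.

Definition weyl_coord (w : 'cV[F]_10) : 'M[F]_4 := unvech (invmx T *m w).

Lemma weyl_coord_linear : linear weyl_coord.
Proof. by move=> a u v; rewrite /weyl_coord mulmxDr -scalemxAr unvech_linear. Qed.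

HB.instance Definition _ :=
  GRing.isLinear.Build F 'cV[F]_10 'M[F]_4 *:%R weyl_coord weyl_coord_linear.

Lemma weyl_vectorK x : weyl_coord (ver x) = x *m x^T.
Proof. by rewrite /weyl_coord /weyl_vector mulKmx // vechK // trmx_mul trmxK. Qed.

(** Symmetric matrices are spanned by the matrices x x^T, the mixed products
    being obtained by polarization. *)
Lemma weyl_vector_span (U : set 'cV[F]_10) : subspace U -> (forall x, U (ver x)) -> U = setT.
Proof.
move=> [U0 Ulin] hU; apply/seteqP; split=> // w _.
have UD u v : U u -> U v -> U (u + v) by move=> Uu Uv; have := Ulin 1 u v Uu Uv; rewrite scale1r.
have UZ a u : U u -> U (a *: u) by move=> Uu; have := Ulin a u 0 Uu U0; rewrite addr0.
have UB u v : U u -> U v -> U (u - v).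
  by move=> Uu Uv; rewrite -scaleN1r; apply: UD => //; apply: UZ.
rewrite -(mulKVmx Tu w) [invmx T *m w]matrix_sum_delta mulmx_sumr.
apply: big_ind => // k _; rewrite big_ord1 -scalemxAr; apply: UZ.
pose b i : 'cV[F]_4 := delta_mx (inord i) 0.
have smxE i j : red F (smx i j) = b i *m (b j)^T by rewrite red_delta trmx_delta mul_delta_mx.
have -> : delta_mx k 0 = vech (red F (unvech (delta_mx k 0))) :> 'cV[F]_10.
  by rewrite -red_vech unvechK red_delta.
rewrite unvech_delta /=; set i := nth _ _ _; set j := nth _ _ _.
case: ifP => _; first by rewrite smxE; apply: hU.
have -> : T *m vech (red F (smx i j + smx j i)) = ver (b i + b j) - ver (b i) - ver (b j).
  rewrite /red map_mxD -!/(red F _) !smxE.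
  have := weyl_vectorE (b i) (b j) 1 1; rewrite !expr1n mulr1 !scale1r => ->.
  by rewrite addrAC addrK addrC addKr.
exact: (UB _ _ (UB _ _ (hU _) (hU _)) (hU _)).
Qed.

Definition cover_vector (x : 'cV[F]_4) : 'cV[F]_10 * F' := (ver x, quartic_coord x).

Lemma cover_vectorZ a x : cover_vector (a *: x) = a ^+ 2 *: cover_vector x.
Proof.
rewrite /cover_vector weyl_vectorZ; congr pair.
rewrite /= /quartic_coord /sp_form !mxE.
by rewrite -[RHS]/((a ^+ 2) ^+ 2 * (_ * _)); ring.
Qed.

(** On an isotropic plane both x_0^2 and [sp_form] are additive up to squares of
    the scalars, so their product has no terms in s t^3 and s^3 t. *)
Lemma cover_vector_line u1 u2 : sympl u1 u2 = 0 -> exists w, forall s t,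
  cover_vector (s *: u1 + t *: u2)
  = s ^+ 2 *: cover_vector u1 + (s * t) *: w + t ^+ 2 *: cover_vector u2.
Proof.
move=> u12; exists (T *m vech (u1 *m u2^T + u2 *m u1^T),
   u1 (inord 0) 0 ^+ 2 * sp_form u2 + u2 (inord 0) 0 ^+ 2 * sp_form u1) => s t.
rewrite /cover_vector weyl_vectorE; congr pair.
rewrite /= /quartic_coord sp_form_lin // !mxE char2_sqrD.
rewrite -[RHS]/((s ^+ 2) ^+ 2 * (_ * _) + (s * t) ^+ 2 * (_ + _) + (t ^+ 2) ^+ 2 * (_ * _)).
ring.
Qed.

(** The alternating sum over the subsets of three vectors kills every quadratic
    map, but takes the value a in the new coordinate for b0, a b1, b2: a
    vector of the form (0, a). *)
Lemma cover_vector_span (U : set ('cV[F]_10 * F')) :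
  subspace U -> (forall x, U (cover_vector x)) -> U = setT.
Proof.
move=> [U0 Ulin] hU; apply/seteqP; split=> // -[w c] _.
have UD u v : U u -> U v -> U (u + v) by move=> Uu Uv; have := Ulin 1 u v Uu Uv; rewrite scale1r.
have UN u : U u -> U (- u).
  by move=> Uu; have := Ulin (-1) u 0 Uu U0; rewrite addr0 scaleN1r.
have proj : [set w | exists c', U (w, c')] = setT.
  apply: weyl_vector_span => [|x]; last by exists (quartic_coord x); exact: hU.
  split; first by exists 0.
  by move=> a u v [d hd] [e he]; exists (a *: d + e); exact: (Ulin a _ _ hd he).
have [c' hc'] : [set w | exists c', U (w, c')] w by rewrite proj.
suff fib a : U (0, a).
  have := UD _ _ hc' (fib (c - c')).
  by rewrite -[(w, c') + _]/(w + 0, c' + (c - c')) addr0 addrC subrK.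
pose b i : 'cV[F]_4 := delta_mx (inord i) 0.
have -> : (0, a) = cover_vector (b 0%N + (a : F) *: b 1%N + b 2%N)
  - cover_vector (b 0%N + (a : F) *: b 1%N) - cover_vector ((a : F) *: b 1%N + b 2%N)
  - cover_vector (b 0%N + b 2%N) + cover_vector (b 0%N) + cover_vector ((a : F) *: b 1%N)
  + cover_vector (b 2%N).
  congr pair.
    rewrite /= /weyl_vector -!mulmxN -!mulmxDr -[LHS](mulmx0 _ T); congr (_ *m _).
    by apply/colP=> i; rewrite !mxE !big_ord1 !mxE; ring.
  rewrite /= /quartic_coord /sp_form !mxE !inord_eq //=.
  rewrite !(mulr0, mul0r, mulr1, mul1r, addr0, add0r, expr1n, expr0n) /=.
  by rewrite !subr0.
by do ?[apply: (UD)]; do ?[apply: (UN)]; exact: hU.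
Qed.

End Weyl.
End Twist.

Lemma bigcup_spinorE (F : fieldType) (P : 'M[F]_5) (W : lmodType F) (Phi : 'cV[F]_4 -> W)
  (q : 'cV[F]_5 -> F) : P \in unitmx ->
  (forall a x, Phi (a *: x) = a ^+ 2 *: Phi x) ->
  forall (X : dps_point q) x, x != 0 -> sval X = star P x ->
  \bigcup_(y in [set y | y != 0 /\ sval X = star P y]) span1 (Phi y) = span1 (Phi x).
Proof.
move=> Pu PhiZ X x x0 hX; apply/seteqP; split=> [w [y [y0 hy]]|w hw]; last by exists x.
have [c yE] : exists c, y = c *: x by apply: (star_inj Pu x0); rewrite -hy.
have c0 : c != 0 by apply: contraNneq y0 => h; rewrite yE h scale0r.
by rewrite yE PhiZ span1Z ?expf_neq0.
Qed.

Theorem theorem6 (F : fieldType) (charF : 2%N \in [pchar F])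
    (q : 'cV[F]_5 -> F) (hq : nonsingular_witt2 q)
    (P : 'M[F]_5) (hP : natural_identification q P)
    (L : B2_lattice 10) (v0 : 'cV[int]_10) (hL : weyl_lattice L 0 2 v0)
    (X0 : dps_point q) (hX0 : stabilized_point P L v0 X0) :
  ~ relatively_universal (G := dual_polar_space q)
      (weyl_embedding P L v0 X0).
Proof.
have [T [Tu Tv TL]] := square_iso F hL.
have Pu : P \in unitmx by case: hP.
pose W1 : lmodType F := ('cV[F]_10 * frobenius_twist charF)%type.
pose Phi : 'cV[F]_4 -> W1 := @cover_vector F charF T.
pose eps1 : dps_point q -> set W1 := fun X =>
  \bigcup_(y in [set y | y != 0 /\ sval X = star P y]) span1 (Phi y).
have eps1E (X : dps_point q) x : x != 0 -> sval X = star P x -> eps1 X = span1 (Phi x).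
  exact: bigcup_spinorE Pu (@cover_vectorZ F charF T) X x.
have weylE := weyl_embeddingE hP Tv TL hX0.
move=> /(_ F W1 eps1); apply; exists fst; last first.
  move=> /bij_inj /(_ (0, 0) (0, 1 : F) erefl) [/esym/eqP].
  by rewrite oner_eq0.
split.
- apply: (veronesean_of_quadratic charF hP (pi := weyl_coord T \o fst)
    (@cover_vectorZ F charF T) _ (@cover_vector_line F charF T) (cover_vector_span Tu) eps1E) => x.
  exact: weyl_vectorK.
- apply: (veronesean_of_quadratic charF hP (pi := weyl_coord T) (weyl_vectorZ T) (weyl_vectorK Tu) _
    (weyl_vector_span Tu) weylE) => u1 u2 _.
  by eexists => s t; exact: weyl_vectorE.
- by exists idfun; split; [exists id|].
- move=> X; have [x x0 hX] := point_star hP X.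
  rewrite (weylE X x x0 hX) (eps1E X x x0 hX); apply/seteqP; split.
    by move=> w [a _ <-]; exists (a *: Phi x) => //; exists a.
  by move=> _ [_ [a _ <-] <-]; exists a.
Qed.
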